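(* Let $\varphi(z)=\left(1+\frac{z}{2}\right)^2=1+z+\frac{z^2}{4}$ and let $f(z)=z+\sum_{n=2}^{\infty}a_nz^n$ belong to the class $\mathcal{C}(\varphi)$. Then the third Hankel determinant $$H_3(1)=\begin{vmatrix}1&a_2&a_3\\ a_2&a_3&a_4\\ a_3&a_4&a_5\end{vmatrix}=a_3(a_2a_4-a_3^2)-a_4(a_4-a_2a_3)+a_5(a_3-a_2^2)$$ of $f$ satisfies $$|H_3(1)|\le \frac{1}{144}.$$ The result is sharp, i.e. there exists a function in $\mathcal{C}(\varphi)$ for which equality holds.
   Context: $\mathbb{D}=\{z\in\mathbb{C}:|z|<1\}$ is the unit disk. $\mathcal{A}$ is the class of analytic functions $f$ in $\mathbb{D}$ with $f(0)=0$ and $f'(0)=1$, so $f(z)=z+\sum_{n=2}^\infty a_nz^n$. For analytic functions $g,h$ in $\mathbb{D}$, $g\prec h$ ($g$ is subordinate to $h$) means that there is an analytic function $\omega:\mathbb{D}\to\mathbb{D}$ with $\omega(0)=0$ such that $g(z)=h(\omega(z))$ for all $z\in\mathbb{D}$. With $\varphi(z)=(1+z/2)^2$, the class $\mathcal{C}(\varphi)$ consists of all $f\in\mathcal{A}$ such that $1+\frac{zf''(z)}{f'(z)}\prec\varphi(z)$ in $\mathbb{D}$ (in particular $f'(z)\ne 0$ in $\mathbb{D}$). *)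

(* Defs.v *)
From Stdlib Require Import Reals Lra.
From Coquelicot Require Import Coquelicot.

Open Scope C_scope.

Definition in_disk (z : C) : Prop := (Cmod z < 1)%R.

(** Functions on the unit disk are represented by total functions [C -> C];
    only their values on the disk are ever constrained. *)
Definition analytic_on_disk (f : C -> C) : Prop :=
  forall z : C, in_disk z -> ex_derive f z.

Definition class_A (f : C -> C) : Prop :=
  analytic_on_disk f /\ f 0 = 0 /\ C_derive f 0 = 1.

Definition taylor_coeffs (f : C -> C) (a : nat -> C) : Prop :=
  forall z : C, in_disk z -> is_pseries a z (f z).

Definition subordinate (g h : C -> C) : Prop :=
  exists w : C -> C,
    analytic_on_disk w /\
    (forall z : C, in_disk z -> in_disk (w z)) /\
    w 0 = 0 /\
    (forall z : C, in_disk z -> g z = h (w z)).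

(** The derivative is required not to vanish because division in [C] is total:
    otherwise the quotient would take a junk value at a zero of [f']. *)
Definition class_C (phi : C -> C) (f : C -> C) : Prop :=
  class_A f /\
  (forall z : C, in_disk z -> C_derive f z <> 0) /\
  subordinate (fun z => 1 + z * C_derive (C_derive f) z / C_derive f z) phi.

Definition phi_limacon (z : C) : C := (1 + z / 2) ^ 2.

Definition det3 (m11 m12 m13 m21 m22 m23 m31 m32 m33 : C) : C :=
  m11 * (m22 * m33 - m23 * m32)
  - m12 * (m21 * m33 - m23 * m31)
  + m13 * (m21 * m32 - m22 * m31).

Definition hankel3 (a : nat -> C) : C :=
  det3 1         (a 2%nat) (a 3%nat)
       (a 2%nat) (a 3%nat) (a 4%nat)
       (a 3%nat) (a 4%nat) (a 5%nat).

Lemma phi_limaconE (z : C) : phi_limacon z = 1 + z + z ^ 2 / 4.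
Proof.
unfold phi_limacon; field; split; intros H; injection H; intros; lra.
Qed.

Lemma hankel3E (a : nat -> C) :
  hankel3 a =
    a 3%nat * (a 2%nat * a 4%nat - a 3%nat ^ 2)
    - a 4%nat * (a 4%nat - a 2%nat * a 3%nat)
    + a 5%nat * (a 3%nat - a 2%nat ^ 2).
Proof. unfold hankel3, det3; ring. Qed.

(* Main.v *)
Require Import Defs.
From Stdlib Require Import Reals Lra Lia Psatz Classical ClassicalEpsilon.
From Coquelicot Require Import Coquelicot.

(** Write [1 + z f''/f' = phi_limacon (w z)], so that [4 z f'' = w (4 + w) f'].  Comparing
    coefficients expresses [a 2, ..., a 5] through the first four coefficients of the Schwarz
    function [w], and the Schur algorithm expresses those through four free parameters
    [c, x, y, u] of the closed disk.  The determinant becomes affine in [u] and quadratic in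
    [y]; the triangle inequality then leaves a polynomial inequality in [|c|, |x|, |y|] which
    has enough slack to be checked by Bernstein expansion.  Equality holds for [w z = z ^ 3],
    that is [f' z = exp (z ^ 3 / 3 + z ^ 6 / 24)].

    The Schur algorithm needs the maximum principle for [w] and for the quotients built from
    it.  Cauchy's theorem is avoided: [f'] is a power series, so all these functions have
    finite Taylor expansions with bounded remainder at every point of the disk, and for a
    function [g] with such an expansion [|g|^2 + eps |z|^2] has no local maximum. *)

Open Scope C_scope.
Set Bullet Behavior "Strict Subproofs".

(** * Finite Taylor expansions *)

(** The value 1/144 is 960/138240. Multiplying the determinant by 138240 clears all denominators,
    and at [w z = z ^ 3], that is at [c = x = 0] and [|y| = 1], only the term in [y ^ 2] survives,
    with modulus 960. The polynomial inequality is tight there, so the estimates that simplify it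
    beforehand must lose nothing at that point. Dividing by [z] costs one order of expansion at the
    origin. Since [w] has expansions of every finite order, the loss is paid in advance: order 9 for
    [w] leaves order 5 after four divisions, enough to name the coefficients, and the maximum
    principle needs only order 3. A Schur parameter of modulus one would stop the algorithm. The
    step is therefore stated as an identity without division, which the zero function then
    satisfies, and no case distinction reaches the determinant. *)

Definition near0 (P : C -> Prop) : Prop :=
  exists d : R, (0 < d)%R /\ forall h : C, (Cmod h < d)%R -> P h.

Lemma near0_and (P Q : C -> Prop) :
  near0 P -> near0 Q -> near0 (fun h => P h /\ Q h).
Proof.
intros [d [Hd HP]] [e [He HQ]]; exists (Rmin d e); split.
- now apply Rmin_glb_lt.
- intros h Hh; split; [apply HP | apply HQ]; eapply Rlt_le_trans; eauto;
    [apply Rmin_l | apply Rmin_r].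
Qed.

Lemma near0_imp (P Q : C -> Prop) :
  (forall h, P h -> Q h) -> near0 P -> near0 Q.
Proof. intros H [d [Hd HP]]; exists d; split; auto. Qed.

Lemma near0_all (P : C -> Prop) : (forall h, P h) -> near0 P.
Proof. intros H; exists 1%R; split; [lra | auto]. Qed.

Lemma near0_ball (d : R) : (0 < d)%R -> near0 (fun h => (Cmod h < d)%R).
Proof. intros H; exists d; auto. Qed.

(** The ball in [near0] contains its centre, so the leading coefficient of an expansion can be read
    off as the value at 0. *)
Lemma near0_at0 (P : C -> Prop) : near0 P -> P 0.
Proof. intros [d [Hd H]]; apply H; now rewrite Cmod_0. Qed.

Definition locally_bounded (g : C -> C) : Prop :=
  exists K : R, near0 (fun h => (Cmod (g h) <= K)%R).

(** A Taylor polynomial of degree below [n] at 0 with remainder [O(h ^ n)]. Peeling off one factor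
    [h] at a time turns closure under the field operations into plain inductions. *)
Fixpoint expandable (n : nat) (g : C -> C) : Prop :=
  match n with
  | O => locally_bounded g
  | S m => exists (c : C) (g1 : C -> C),
      near0 (fun h => g h = c + h * g1 h) /\ expandable m g1
  end.

Lemma expandable_ext (n : nat) (g k : C -> C) :
  near0 (fun h => g h = k h) -> expandable n g -> expandable n k.
Proof.
intros H; destruct n as [|n]; simpl.
- intros [K HK]; exists K.
  eapply near0_imp; [|exact (near0_and _ _ H HK)].
  now intros h [<- Hh].
- intros [c [g1 [H1 H2]]]; exists c, g1; split; auto.
  eapply near0_imp; [|exact (near0_and _ _ H H1)].
  now intros h [<- Hh].
Qed.

Lemma expandable_bounded (n : nat) (g : C -> C) :
  expandable n g -> locally_bounded g.
Proof.
revert g; induction n as [|n IH]; intros g; simpl; auto.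
intros [c [g1 [H1 H2]]]; destruct (IH _ H2) as [K HK].
exists (Cmod c + K)%R.
eapply near0_imp;
  [|exact (near0_and _ _ (near0_ball 1 Rlt_0_1) (near0_and _ _ H1 HK))].
intros h (Hh & -> & HK').
eapply Rle_trans; [apply Cmod_triangle|]; rewrite Cmod_mult.
pose proof (Cmod_ge_0 h); pose proof (Cmod_ge_0 (g1 h)); nra.
Qed.

Lemma expandable_pred (n : nat) (g : C -> C) :
  expandable (S n) g -> expandable n g.
Proof.
revert g; induction n as [|n IH]; intros g H.
- exact (expandable_bounded _ _ H).
- destruct H as [c [g1 [H1 H2]]]; exists c, g1; auto.
Qed.

Lemma expandable_const (n : nat) (c : C) : expandable n (fun _ => c).
Proof.
revert c; induction n as [|n IH]; intros c.
- exists (Cmod c); apply near0_all; intros; apply Rle_refl.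
- exists c, (fun _ => 0); split; auto.
  apply near0_all; intros; ring.
Qed.

Lemma expandable_id (n : nat) : expandable n (fun h => h).
Proof.
destruct n as [|n].
- exists 1%R; exists 1%R; split; [lra|]; intros; lra.
- exists 0, (fun _ => 1); split; [|apply expandable_const].
  apply near0_all; intros; ring.
Qed.

Lemma expandable_add (n : nat) (g k : C -> C) :
  expandable n g -> expandable n k -> expandable n (fun h => g h + k h).
Proof.
revert g k; induction n as [|n IH]; intros g k.
- intros [K HK] [L HL]; exists (K + L)%R.
  eapply near0_imp; [|exact (near0_and _ _ HK HL)].
  intros h [H1 H2]; eapply Rle_trans; [apply Cmod_triangle|lra].
- intros [c [g1 [H1 H2]]] [d [k1 [H3 H4]]].
  exists (c + d), (fun h => g1 h + k1 h); split; [|now apply IH].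
  eapply near0_imp; [|exact (near0_and _ _ H1 H3)].
  intros h [-> ->]; ring.
Qed.

Lemma expandable_mul (n : nat) (g k : C -> C) :
  expandable n g -> expandable n k -> expandable n (fun h => g h * k h).
Proof.
revert g k; induction n as [|n IH]; intros g k.
- intros [K HK] [L HL]; exists (K * L)%R.
  eapply near0_imp; [|exact (near0_and _ _ HK HL)].
  intros h [H1 H2]; rewrite Cmod_mult.
  apply Rmult_le_compat; auto; apply Cmod_ge_0.
- intros [c [g1 [H1 H2]]] [d [k1 [H3 H4]]].
  exists (c * d), (fun h => (c * k1 h + d * g1 h) + h * (g1 h * k1 h)); split.
  + eapply near0_imp; [|exact (near0_and _ _ H1 H3)].
    intros h [-> ->]; ring.
  + apply (expandable_add n (fun h => c * k1 h + d * g1 h)).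
    * apply (expandable_add n (fun h => c * k1 h));
        apply IH; auto using expandable_const.
    * apply (IH (fun h => h)); [apply expandable_id|auto].
Qed.

(** From [/ g - / c = - (g - c) / (c * g)]: once [h] is peeled off, what is left is a product
    containing [/ g] at one order lower, which the induction provides. *)
Lemma expandable_inv (n : nat) (g : C -> C) (m : R) :
  (0 < m)%R -> near0 (fun h => (m <= Cmod (g h))%R) ->
  expandable n g -> expandable n (fun h => / g h).
Proof.
intros Hm Hg; induction n as [|n IH]; intros H.
- exists (/ m)%R; eapply near0_imp; [|exact Hg].
  intros h Hh; rewrite Cmod_inv; [now apply Rinv_le_contravar|].
  cbv beta in Hh; intros E; rewrite E, Cmod_0 in Hh; lra.
- assert (H' := IH (expandable_pred _ _ H)).
  destruct H as [c [g1 [H1 H2]]].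
  exists (/ c), (fun h => (- / c * g1 h) * / g h); split.
  + assert (Hc : c <> 0).
    { intros Hc; pose proof (near0_at0 _ H1) as E; pose proof (near0_at0 _ Hg) as L.
      simpl in E, L; rewrite E, Hc in L; replace (0 + 0 * g1 0) with (RtoC 0) in L by ring.
      rewrite Cmod_0 in L; lra. }
    eapply near0_imp; [|exact (near0_and _ _ Hg H1)].
    intros h [L E0].
    assert (g h <> 0) by (intros E; rewrite E, Cmod_0 in L; lra).
    assert (E : g1 h * h = g h - c) by (rewrite E0; ring).
    replace (h * (- / c * g1 h * / g h)) with (- / c * (g1 h * h) * / g h) by ring.
    rewrite E; field; auto.
  + apply (expandable_mul n (fun h => - / c * g1 h)); auto.
    apply (expandable_mul n (fun _ => - / c)); auto using expandable_const.
Qed.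

Lemma expandable_sub (n : nat) (g k : C -> C) :
  expandable n g -> expandable n k -> expandable n (fun h => g h - k h).
Proof.
intros H1 H2.
apply (expandable_ext n (fun h => g h + -(1) * k h)).
- apply near0_all; intros; ring.
- apply (expandable_add n g); auto.
  apply (expandable_mul n (fun _ => -(1))); auto using expandable_const.
Qed.

Lemma expandable_continuous (n : nat) (g : C -> C) (eps : R) :
  expandable (S n) g -> (0 < eps)%R ->
  near0 (fun h => (Cmod (g h - g 0) < eps)%R).
Proof.
intros [c [g1 [H1 H2]]] He; destruct (expandable_bounded _ _ H2) as [K HK].
assert (HK0 : (0 <= K)%R)
  by (eapply Rle_trans; [apply Cmod_ge_0|exact (near0_at0 _ HK)]).
assert (Hd : (0 < eps / (K + 1))%R) by (apply Rdiv_lt_0_compat; lra).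
eapply near0_imp;
  [|exact (near0_and _ _ (near0_ball _ Hd) (near0_and _ _ H1 HK))].
intros h (Hh & E & L); rewrite E, (near0_at0 _ H1).
replace (c + h * g1 h - (c + 0 * g1 0)) with (h * g1 h) by ring.
rewrite Cmod_mult; apply Rle_lt_trans with (Cmod h * (K + 1))%R.
- apply Rmult_le_compat_l; [apply Cmod_ge_0|lra].
- apply Rlt_le_trans with (eps / (K + 1) * (K + 1))%R;
    [apply Rmult_lt_compat_r; lra | right; field; lra].
Qed.

Lemma expandable_nonzero (n : nat) (g : C -> C) :
  expandable (S n) g -> g 0 <> 0 ->
  near0 (fun h => (Cmod (g 0) / 2 <= Cmod (g h))%R).
Proof.
intros H Hg; assert (P := proj1 (Cmod_gt_0 _) Hg).
eapply near0_imp; [|exact (expandable_continuous n g (Cmod (g 0) / 2) H ltac:(lra))].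
intros h Hh; simpl in Hh.
assert (T := Cmod_triangle (g h) (- (g h - g 0))).
rewrite Cmod_opp in T; replace (g h + - (g h - g 0)) with (g 0) in T by ring; lra.
Qed.

(** * Maximum principle *)

Lemma Cmod_le_abs (z : C) : (Cmod z <= Rabs (fst z) + Rabs (snd z))%R.
Proof.
replace z with (RtoC (fst z) + Ci * RtoC (snd z)) at 1
  by (destruct z; apply injective_projections; simpl; ring).
eapply Rle_trans; [apply Cmod_triangle|].
rewrite Cmod_mult, !Cmod_R, Cmod_Ci; lra.
Qed.

(** Compactness of the square [[-r, r] ^ 2]. The gauge at [p] is chosen so small that its inverse
    bounds [v] near [p]; a uniform lower bound [d] of the gauges in use then gives the bound
    [/ d]. *)
Lemma disk_bounded_of_locally_bounded (r : R) (v : C -> R) :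
  (forall z0, (Cmod z0 <= r)%R -> exists K : R,
     near0 (fun h => (Cmod (z0 + h) <= r)%R -> (v (z0 + h)%C <= K)%R)) ->
  exists K : R, forall z, (Cmod z <= r)%R -> (v z <= K)%R.
Proof.
intros H.
assert (G : forall p : C, exists d : posreal,
  forall z : C, (Cmod z <= r)%R -> (Rabs (fst z - fst p) < d)%R ->
    (Rabs (snd z - snd p) < d)%R -> (v z <= / d)%R).
{ intros p; destruct (Rle_or_lt (Cmod p) r) as [Hp|Hp].
  - destruct (H p Hp) as [K [d [Hd HK]]].
    assert (Hm : (0 < Rmin (d / 2) (/ (Rabs K + 1)))%R).
    { apply Rmin_glb_lt; [lra|]; apply Rinv_0_lt_compat.
      pose proof (Rabs_pos K); lra. }
    exists (mkposreal _ Hm); simpl; intros z Hz H1 H2.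
    assert (L1 := Rmin_l (d / 2) (/ (Rabs K + 1))).
    assert (L2 := Rmin_r (d / 2) (/ (Rabs K + 1))).
    apply Rle_trans with K.
    + replace z with (p + (z - p)) in Hz |- * by ring.
      apply HK; auto.
      eapply Rle_lt_trans; [apply Cmod_le_abs|]; simpl.
      unfold Rminus in H1, H2; lra.
    + apply Rle_trans with (Rabs K + 1)%R; [pose proof (Rle_abs K); lra|].
      rewrite <- (Rinv_inv (Rabs K + 1)) at 1.
      apply Rinv_le_contravar; simpl; auto.
  (* Around a point outside the disk the gauge is too small to reach the disk, so there is nothing
     to bound. *)
  - assert (Hp2 : (0 < (Cmod p - r) / 2)%R) by lra.
    exists (mkposreal _ Hp2); simpl; intros z Hz H1 H2; exfalso.
    assert (T := Cmod_triangle z (p - z)).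
    replace (z + (p - z)) with p in T by ring.
    rewrite <- (Cmod_opp (p - z)) in T.
    assert (T2 := Cmod_le_abs (- (p - z))); simpl in T2.
    replace (- (fst p + - fst z))%R with (fst z - fst p)%R in T2 by ring.
    replace (- (snd p + - snd z))%R with (snd z - snd p)%R in T2 by ring.
    lra. }
pose (delta := fun x y => proj1_sig (constructive_indefinite_description _ (G (x, y)))).
destruct (compactness_value_2d (- r) r (- r) r delta) as [d Hd].
exists (/ d)%R; intros z Hz.
(* [compactness_value_2d] yields its witness under a double negation, hence the goal [False]. *)
apply Rnot_lt_le; intros Hlt.
assert (M := Rmax_Cmod z).
assert (M1 := Rmax_l (Rabs (fst z)) (Rabs (snd z))).
assert (M2 := Rmax_r (Rabs (fst z)) (Rabs (snd z))).
apply (Hd (fst z) (snd z)).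
- apply Rabs_le_between; lra.
- apply Rabs_le_between; lra.
- intros (x & y & _ & _ & A1 & A2 & A3); unfold delta in A1, A2, A3.
  destruct (constructive_indefinite_description _ (G (x, y))) as [e He].
  simpl in A1, A2, A3.
  assert (B := He z Hz A1 A2).
  assert (/ e <= / d)%R by (apply Rinv_le_contravar; auto; apply cond_pos).
  lra.
Qed.

(** If the supremum [m] were not attained, [/ (m - u)] would be locally bounded, hence bounded by
    some [L], and [m - / L] would be a smaller upper bound. *)
Lemma disk_max_attained (r : R) (u : C -> R) :
  (0 <= r)%R ->
  (forall z0 eps, (Cmod z0 <= r)%R -> (0 < eps)%R ->
     near0 (fun h => (Rabs (u (z0 + h)%C - u z0) < eps)%R)) ->
  exists z0, (Cmod z0 <= r)%R /\ forall z, (Cmod z <= r)%R -> (u z <= u z0)%R.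
Proof.
intros Hr Hu.
destruct (disk_bounded_of_locally_bounded r u) as [K HK].
{ intros z0 Hz0; exists (u z0 + 1)%R.
  eapply near0_imp; [|exact (Hu z0 1%R Hz0 Rlt_0_1)].
  intros h Hh _; apply Rabs_def2 in Hh; lra. }
destruct (completeness (fun y => exists z, (Cmod z <= r)%R /\ y = u z)) as [m [Hm1 Hm2]].
{ exists K; intros y (z & Hz & ->); auto. }
{ exists (u 0), 0; rewrite Cmod_0; auto. }
apply NNPP; intros Hno.
assert (Hlt : forall z, (Cmod z <= r)%R -> (u z < m)%R).
{ intros z Hz; destruct (Rle_lt_or_eq_dec (u z) m) as [|E]; auto.
  - apply Hm1; eauto.
  - exfalso; apply Hno; exists z; split; auto.
    intros z' Hz'; rewrite E; apply Hm1; eauto. }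
destruct (disk_bounded_of_locally_bounded r (fun z => / (m - u z))%R) as [L HL].
{ intros z0 Hz0; exists (/ ((m - u z0) / 2))%R.
  assert (P := Hlt z0 Hz0).
  eapply near0_imp; [|exact (Hu z0 ((m - u z0) / 2)%R Hz0 ltac:(lra))].
  intros h Hh _; apply Rabs_def2 in Hh.
  apply Rinv_le_contravar; lra. }
assert (L0 : (0 < L)%R).
{ apply Rlt_le_trans with (/ (m - u 0))%R.
  - apply Rinv_0_lt_compat; specialize (Hlt 0); rewrite Cmod_0 in Hlt; lra.
  - apply HL; now rewrite Cmod_0. }
assert (Hub : (m <= m - / L)%R).
{ apply Hm2; intros y (z & Hz & ->).
  assert (P := Hlt z Hz); assert (Q := HL z Hz); cbv beta in Q.
  assert (/ L <= / / (m - u z))%R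
    by (apply Rinv_le_contravar; auto; apply Rinv_0_lt_compat; lra).
  rewrite Rinv_inv in H; lra. }
assert (0 < / L)%R by now apply Rinv_0_lt_compat.
lra.
Qed.

Lemma Cmod_sqr_add_ge (P Q : C) :
  (Cmod P ^ 2 - 2 * Cmod P * Cmod Q <= Cmod (P + Q) ^ 2)%R.
Proof.
assert (T := Cmod_triangle (P + Q) (- Q)).
replace (P + Q + - Q) with P in T by ring.
rewrite Cmod_opp in T.
pose proof (Cmod_ge_0 P); pose proof (Cmod_ge_0 Q); pose proof (Cmod_ge_0 (P + Q)).
destruct (Rle_lt_dec (Cmod Q) (Cmod P)); nra.
Qed.

(* Averaging over the four directions [h], [ih], [-h], [-ih] kills the cross terms of [|P|^2]. *)
Lemma no_strict_local_max (z0 : C) (g : C -> C) (eps : R) :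
  (0 < eps)%R -> expandable 3 g ->
  ~ near0 (fun h => (Cmod (g h) ^ 2 + eps * Cmod (z0 + h) ^ 2 <=
                    Cmod (g 0) ^ 2 + eps * Cmod z0 ^ 2)%R).
Proof.
intros He [e0 [g1 [H1 [e1 [g2 [H2 [e2 [g3 [H3 [K H4]]]]]]]]]] Hmax.
assert (E0 : g 0 = e0) by (rewrite (near0_at0 _ H1); ring).
assert (HK0 : (0 <= K)%R)
  by (eapply Rle_trans; [apply Cmod_ge_0|exact (near0_at0 _ H4)]).
destruct (near0_and _ _ H1 (near0_and _ _ H2 (near0_and _ _ H3 (near0_and _ _ H4 Hmax))))
  as [d [Hd HH]].
clear H1 H2 H3 H4 Hmax.
set (L := (Cmod e0 + Cmod e1 + Cmod e2)%R).
assert (HL : (0 <= L)%R)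
  by (unfold L; pose proof (Cmod_ge_0 e0); pose proof (Cmod_ge_0 e1);
      pose proof (Cmod_ge_0 e2); lra).
assert (Hpos : (0 < 2 * L * K + 1)%R) by nra.
(* A step so short that the gain [eps * t ^ 2] from the perturbation beats the error
   [2 * L * K * t ^ 3] from the remainder. *)
set (t := Rmin (Rmin (d / 2) 1) (eps / (2 * L * K + 1) / 2)).
assert (Ht : (0 < t)%R).
{ unfold t; repeat apply Rmin_glb_lt; try lra.
  assert (0 < eps / (2 * L * K + 1))%R by now apply Rdiv_lt_0_compat. lra. }
assert (Ht1 : (t <= 1)%R)
  by (unfold t; eapply Rle_trans; [apply Rmin_l|apply Rmin_r]).
assert (Htd : (t < d)%R).
{ apply Rle_lt_trans with (d / 2)%R; [|lra].
  unfold t; eapply Rle_trans; [apply Rmin_l|apply Rmin_l]. }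
assert (Hte : (t * (2 * L * K + 1) < eps)%R).
{ apply Rle_lt_trans with (eps / (2 * L * K + 1) / 2 * (2 * L * K + 1))%R.
  - apply Rmult_le_compat_r; [lra|apply Rmin_r].
  - replace (eps / (2 * L * K + 1) / 2 * (2 * L * K + 1))%R with (eps / 2)%R
      by (field; lra). lra. }
assert (Hdir : forall h, Cmod h = t ->
  (Cmod (e0 + h * (e1 + h * e2)) ^ 2 - 2 * L * K * t ^ 3 + eps * Cmod (z0 + h) ^ 2 <=
   Cmod e0 ^ 2 + eps * Cmod z0 ^ 2)%R).
{ intros h Hh; destruct (HH h) as (F1 & F2 & F3 & F4 & F5); [lra|].
  rewrite E0 in F5; eapply Rle_trans; [|exact F5].
  apply Rplus_le_compat_r; rewrite F1, F2, F3.
  replace (e0 + h * (e1 + h * (e2 + h * g3 h)))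
    with ((e0 + h * (e1 + h * e2)) + h * h * h * g3 h) by ring.
  eapply Rle_trans; [|apply Cmod_sqr_add_ge].
  assert (A : (Cmod (e0 + h * (e1 + h * e2)) <= L)%R).
  { eapply Rle_trans; [apply Cmod_triangle|]; rewrite Cmod_mult, Hh.
    assert (T := Cmod_triangle e1 (h * e2)); rewrite Cmod_mult, Hh in T.
    pose proof (Cmod_ge_0 e0); pose proof (Cmod_ge_0 e1); pose proof (Cmod_ge_0 e2).
    pose proof (Cmod_ge_0 (e1 + h * e2)); unfold L; nra. }
  assert (B : (Cmod (h * h * h * g3 h) <= K * t ^ 3)%R).
  { rewrite !Cmod_mult, Hh; replace (t * t * t)%R with (t ^ 3)%R by ring.
    rewrite Rmult_comm; apply Rmult_le_compat_r; [apply pow_le; lra|exact F4]. }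
  pose proof (Cmod_ge_0 (e0 + h * (e1 + h * e2))).
  pose proof (Cmod_ge_0 (h * h * h * g3 h)).
  assert (Cmod (e0 + h * (e1 + h * e2)) * Cmod (h * h * h * g3 h) <= L * (K * t ^ 3))%R
    by (apply Rmult_le_compat; auto).
  lra. }
assert (Hti : Cmod (RtoC t) = t) by (rewrite Cmod_R; apply Rabs_pos_eq; lra).
assert (D1 := Hdir (RtoC t) Hti).
assert (D2 := Hdir (Ci * RtoC t)).
assert (D3 := Hdir (- RtoC t)).
assert (D4 := Hdir (- (Ci * RtoC t))).
rewrite Cmod_opp in D3, D4; rewrite Cmod_mult, Cmod_Ci, Rmult_1_l in D2, D4.
rewrite Hti in D2, D3, D4.
specialize (D2 eq_refl); specialize (D3 eq_refl); specialize (D4 eq_refl).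
rewrite !Cmod2_alt in D1, D2, D3, D4.
destruct e0 as [a0 b0], e1 as [a1 b1], e2 as [a2 b2], z0 as [x0 y0].
unfold Re, Im in *; simpl in D1, D2, D3, D4.
(* The sum of the four inequalities; the terms [|e1| ^ 2 * t ^ 2] and [|e2| ^ 2 * t ^ 4] that remain
   on the left are nonnegative. *)
assert (F : (eps * t ^ 2 <= 2 * L * K * t ^ 3)%R) by nra.
assert (0 < t ^ 2)%R by (apply pow_lt; lra).
assert (eps <= 2 * L * K * t)%R by (apply Rmult_le_reg_r with (t ^ 2)%R; nra).
nra.
Qed.

(** * Schwarz lemma and Schur algorithm *)

Lemma near0_Cmod_sqr (g : C -> C) (a : C) :
  (forall e, (0 < e)%R -> near0 (fun h => (Cmod (g h - a) < e)%R)) ->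
  forall e, (0 < e)%R -> near0 (fun h => (Rabs (Cmod (g h) ^ 2 - Cmod a ^ 2) < e)%R).
Proof.
intros H e He.
assert (Pa := Cmod_ge_0 a).
assert (Hm : (0 < Rmin 1 (e / (2 * Cmod a + 1)))%R)
  by (apply Rmin_glb_lt; [lra|apply Rdiv_lt_0_compat; lra]).
eapply near0_imp; [|exact (H _ Hm)].
intros h Hh; cbv beta in Hh.
assert (L1 := Rlt_le_trans _ _ _ Hh (Rmin_l _ _)).
assert (L2 := Rlt_le_trans _ _ _ Hh (Rmin_r _ _)).
assert (L3 : (Cmod (g h - a) * (2 * Cmod a + 1) < e)%R).
{ apply Rmult_lt_compat_r with (r := (2 * Cmod a + 1)%R) in L2; [|lra].
  replace (e / (2 * Cmod a + 1) * (2 * Cmod a + 1))%R with e in L2 by (field; lra).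
  exact L2. }
assert (T1 := Cmod_triangle a (g h - a)).
replace (a + (g h - a)) with (g h) in T1 by ring.
assert (T2 := Cmod_triangle (g h) (- (g h - a))).
replace (g h + - (g h - a)) with a in T2 by ring; rewrite Cmod_opp in T2.
pose proof (Cmod_ge_0 (g h - a)); pose proof (Cmod_ge_0 (g h)).
apply Rabs_def1; nra.
Qed.

Lemma expandable_shift_continuous (n : nat) (g : C -> C) (z0 : C) (eps : R) :
  expandable (S n) (fun h => g (z0 + h)) -> (0 < eps)%R ->
  near0 (fun h => (Cmod (g (z0 + h)%C - g z0) < eps)%R).
Proof.
intros H He; generalize (expandable_continuous n _ eps H He).
now rewrite Cplus_0_r.
Qed.

Lemma in_disk_0 : in_disk 0.
Proof. unfold in_disk; rewrite Cmod_0; lra. Qed.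

Lemma in_disk_near (z : C) (r : R) : (Cmod z < r)%R -> near0 (fun h => (Cmod (z + h) < r)%R).
Proof.
intros H; eapply near0_imp; [|apply (near0_ball (r - Cmod z)); lra].
intros h Hh; cbv beta in Hh; eapply Rle_lt_trans; [apply Cmod_triangle|lra].
Qed.

(** The function [|g| ^ 2 + eps |z| ^ 2] attains its maximum, and not in the interior. With
    [eps = e / r ^ 2] the perturbation equals [e] on the boundary circle, and [e] is arbitrary. *)
Lemma disk_max_principle (r M : R) (g : C -> C) :
  (0 < r)%R ->
  (forall z0, (Cmod z0 <= r)%R -> expandable 3 (fun h => g (z0 + h))) ->
  (forall z, Cmod z = r -> (Cmod (g z) <= M)%R) ->
  forall z, (Cmod z <= r)%R -> (Cmod (g z) <= M)%R.
Proof.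
intros Hr Hg HM z1 Hz1.
assert (HM0 : (0 <= M)%R).
{ eapply Rle_trans; [apply Cmod_ge_0|apply (HM (RtoC r))].
  rewrite Cmod_R; apply Rabs_pos_eq; lra. }
assert (Hr2 : (0 < r ^ 2)%R) by (apply pow_lt; lra).
assert (Hsq : (Cmod (g z1) ^ 2 <= M ^ 2)%R).
{ apply le_epsilon; intros e He.
  assert (He' : (0 < e / r ^ 2)%R) by now apply Rdiv_lt_0_compat.
  set (u := fun z => (Cmod (g z) ^ 2 + e / r ^ 2 * Cmod z ^ 2)%R).
  destruct (disk_max_attained r u) as [z0 [Hz0 Hmax]]; [lra| |].
  - intros z0 eta Hz0 Heta.
    assert (A := near0_Cmod_sqr (fun h => g (z0 + h)) (g z0)
      (fun e0 => expandable_shift_continuous 2 g z0 e0 (Hg z0 Hz0)) (eta / 2)%R ltac:(lra)).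
    assert (B0 : expandable 3 (fun h => z0 + h))
      by (apply (expandable_add 3 (fun _ => z0));
          auto using expandable_const, expandable_id).
    assert (B := near0_Cmod_sqr (fun h => z0 + h) z0
      (fun e0 => expandable_shift_continuous 2 (fun z => z) z0 e0 B0)
      (eta / 2 / (e / r ^ 2))%R ltac:(apply Rdiv_lt_0_compat; lra)).
    eapply near0_imp; [|exact (near0_and _ _ A B)].
    intros h [A1 B1]; unfold u.
    apply Rabs_def2 in A1; apply Rabs_def2 in B1; destruct A1, B1.
    set (k := (e / r ^ 2)%R) in *.
    assert (E : (eta / 2 / k * k = eta / 2)%R) by (field; lra).
    apply Rabs_def1; nra.
  - assert (Hb : (u z0 <= M ^ 2 + e)%R).
    { destruct (Rle_lt_or_eq_dec _ _ Hz0) as [Hlt|Heq].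
      - exfalso.
        apply (no_strict_local_max z0 (fun h => g (z0 + h)) _ He' (Hg z0 Hz0)).
        eapply near0_imp; [|exact (in_disk_near _ _ Hlt)].
        intros h Hh; rewrite Cplus_0_r; apply (Hmax (z0 + h)); cbv beta in Hh; lra.
      - unfold u; rewrite Heq.
        replace (e / r ^ 2 * r ^ 2)%R with e by (field; lra).
        apply Rplus_le_compat_r, pow_incr; split; [apply Cmod_ge_0|auto]. }
    assert (Hz := Hmax z1 Hz1); unfold u in Hz at 1.
    assert (0 <= e / r ^ 2 * Cmod z1 ^ 2)%R
      by (apply Rmult_le_pos; [lra|apply pow2_ge_0]).
    lra. }
pose proof (Cmod_ge_0 (g z1)); nra.
Qed.

(** The bound is not strict, so that unimodular constants are included and a Schur step stays in the
    class. *)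
Definition schur_function (n : nat) (g : C -> C) : Prop :=
  (forall z, in_disk z -> expandable n (fun h => g (z + h))) /\
  (forall z, in_disk z -> (Cmod (g z) <= 1)%R).

Lemma expandable_le (m n : nat) (g : C -> C) :
  (m <= n)%nat -> expandable n g -> expandable m g.
Proof. induction 1; auto using expandable_pred. Qed.

Lemma expandable_shift (n : nat) (z : C) : expandable n (fun h => z + h).
Proof.
apply (expandable_add n (fun _ => z)); auto using expandable_const, expandable_id.
Qed.

(** Schwarz's lemma: [k z / z] is at most [/ r] on the circle of radius [r], hence inside it, and
    [r] may be taken close to 1. At the origin the quotient is the first remainder [k1] of [k],
    which is why one order is lost. *)
Lemma schwarz_quotient (n : nat) (k : C -> C) :
  (3 <= n)%nat -> schur_function (S n) k -> k 0 = 0 ->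
  exists g, schur_function n g /\ forall z, in_disk z -> k z = z * g z.
Proof.
intros Hn [Hk Hk1] Hk0.
assert (D0 := in_disk_0).
destruct (Hk 0 D0) as [c [k1 [E1 E2]]].
assert (Hc : c = 0).
{ assert (E := near0_at0 _ E1); cbv beta in E.
  rewrite Cplus_0_r, Hk0 in E; rewrite E; ring. }
subst c.
set (g := fun z : C => if excluded_middle_informative (z = 0) then k1 0 else k z / z).
assert (G0 : forall z : C, z <> 0 -> g z = k z / z)
  by (intros z Hz; unfold g; destruct (excluded_middle_informative (z = 0)); tauto).
assert (Hkg : forall z, k z = z * g z).
{ intros z; destruct (excluded_middle_informative (z = 0)) as [->|Hz].
  - rewrite Hk0; ring.
  - rewrite G0 by auto; field; auto. }
assert (Hexp : forall z, in_disk z -> expandable n (fun h => g (z + h))).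
{ intros z Hz; destruct (excluded_middle_informative (z = 0)) as [->|Hz0].
  - apply (expandable_ext n k1); auto.
    eapply near0_imp; [|exact E1]; intros h Hh; cbv beta in Hh.
    rewrite Cplus_0_l in Hh |- *; unfold g.
    destruct (excluded_middle_informative (h = 0)) as [->|Hh0]; auto.
    rewrite Hh; field; auto.
  - assert (Hp := proj1 (Cmod_gt_0 _) Hz0).
    assert (Hnz : near0 (fun h => (Cmod z / 2 <= Cmod (z + h))%R)).
    { generalize (expandable_nonzero 0 (fun h => z + h) (expandable_shift 1 z)).
      rewrite Cplus_0_r; auto. }
    apply (expandable_ext n (fun h => k (z + h) * / (z + h))).
    + eapply near0_imp; [|exact Hnz]; intros h Hh; cbv beta in Hh.
      symmetry; apply G0; intros E; rewrite E, Cmod_0 in Hh; lra.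
    + apply (expandable_mul n (fun h => k (z + h))); [apply expandable_pred; auto|].
      apply (expandable_inv n (fun h => z + h) (Cmod z / 2));
        auto using expandable_shift; lra. }
exists g; split; [split; auto|auto].
intros z Hz; unfold in_disk in Hz.
apply Rnot_lt_le; intros Hgt.
(* A radius below 1 that exceeds both [|z|] and [/ |g z|]; the second makes [|g z| <= / r]
   impossible. *)
set (r := Rmax ((1 + Cmod z) / 2) ((1 + / Cmod (g z)) / 2)).
assert (Hgz : (/ Cmod (g z) < 1)%R)
  by (rewrite <- Rinv_1; apply Rinv_lt_contravar; lra).
assert (R1 : ((1 + Cmod z) / 2 <= r)%R) by apply Rmax_l.
assert (R2 : ((1 + / Cmod (g z)) / 2 <= r)%R) by apply Rmax_r.
assert (R3 : (r < 1)%R) by (apply Rmax_lub_lt; lra).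
assert (R0 : (0 < r)%R) by (pose proof (Cmod_ge_0 z); lra).
assert (B : (Cmod (g z) <= / r)%R).
{ apply (disk_max_principle r (/ r) g); auto; try lra.
  - intros z0 Hz0; apply (expandable_le 3 n); auto.
    apply Hexp; unfold in_disk; lra.
  - intros y Hy.
    assert (Hy1 : (Cmod (k y) <= 1)%R) by (apply Hk1; unfold in_disk; lra).
    rewrite Hkg, Cmod_mult, Hy in Hy1.
    apply Rmult_le_reg_l with r; [lra|].
    rewrite Rinv_r; lra. }
assert (/ Cmod (g z) >= r)%R.
{ apply Rle_ge; rewrite <- (Rinv_inv r); apply Rinv_le_contravar; lra. }
lra.
Qed.

Lemma Cmod_conj_mult (a : C) : a * Cconj a = RtoC (Cmod a ^ 2).
Proof.
rewrite Cmod2_alt; destruct a as [x y]; unfold Re, Im.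
apply injective_projections; simpl; ring.
Qed.

(** The squares of the two sides differ by [(1 - |a| ^ 2) * (1 - |b| ^ 2)]. *)
Lemma moebius_le (a b : C) :
  (Cmod a <= 1)%R -> (Cmod b <= 1)%R -> (Cmod (b - a) <= Cmod (1 - Cconj a * b))%R.
Proof.
intros Ha Hb.
apply Rsqr_incr_0; try apply Cmod_ge_0; rewrite !Rsqr_pow2, !Cmod2_alt.
assert (A : (Cmod a ^ 2 <= 1)%R) by (pose proof (Cmod_ge_0 a); nra).
assert (B : (Cmod b ^ 2 <= 1)%R) by (pose proof (Cmod_ge_0 b); nra).
rewrite Cmod2_alt in A, B.
destruct a as [x y], b as [u v]; unfold Re, Im in *; simpl in *; nra.
Qed.

(** Schwarz's lemma for the Moebius transform [(g - a) / (1 - Cconj a * g)], whose denominator has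
    modulus at least [1 - |a|]. *)
Lemma schur_step_lt (n : nat) (g : C -> C) :
  (3 <= n)%nat -> schur_function (S n) g -> (Cmod (g 0) < 1)%R ->
  exists g1, schur_function n g1 /\
    forall z, in_disk z -> g z - g 0 = z * g1 z * (1 - Cconj (g 0) * g z).
Proof.
intros Hn [Hg Hg1] Hlt; set (a := g 0) in *.
assert (Hden : forall z, in_disk z -> (1 - Cmod a <= Cmod (1 - Cconj a * g z))%R).
{ intros z Hz; assert (T := Cmod_triangle (1 - Cconj a * g z) (Cconj a * g z)).
  replace (1 - Cconj a * g z + Cconj a * g z) with (RtoC 1) in T by ring.
  rewrite Cmod_1, Cmod_mult, Cmod_conj in T; specialize (Hg1 z Hz).
  pose proof (Cmod_ge_0 a); pose proof (Cmod_ge_0 (g z)); nra. }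
assert (Hden0 : forall z, in_disk z -> 1 - Cconj a * g z <> 0).
{ intros z Hz E; specialize (Hden z Hz); rewrite E, Cmod_0 in Hden; lra. }
destruct (schwarz_quotient n (fun z => (g z - a) * / (1 - Cconj a * g z)))
  as [g1 [H1 H2]]; auto.
- split.
  + intros z Hz.
    apply (expandable_mul (S n) (fun h => g (z + h) - a)).
    * apply (expandable_sub (S n) (fun h => g (z + h))); auto using expandable_const.
    * apply (expandable_inv (S n) (fun h => 1 - Cconj a * g (z + h)) (1 - Cmod a)); [lra| |].
      -- eapply near0_imp; [|exact (in_disk_near _ _ Hz)]; intros h Hh; apply Hden; auto.
      -- apply (expandable_sub (S n) (fun _ => 1)); auto using expandable_const.
         apply (expandable_mul (S n) (fun _ => Cconj a)); auto using expandable_const.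
  + intros z Hz; specialize (Hden z Hz).
    rewrite Cmod_mult, Cmod_inv by auto.
    assert (M := moebius_le a (g z) ltac:(lra) (Hg1 z Hz)).
    apply Rmult_le_reg_r with (Cmod (1 - Cconj a * g z)); [lra|].
    rewrite Rmult_assoc, Rinv_l by lra; lra.
- fold a; ring.
- exists g1; split; auto.
  intros z Hz; rewrite <- H2 by auto; field; auto.
Qed.

Lemma schur_scale (n : nat) (rho : R) (g : C -> C) :
  (0 <= rho <= 1)%R -> schur_function n g -> schur_function n (fun z => RtoC rho * g z).
Proof.
intros Hr [H1 H2]; split.
- intros z Hz; apply (expandable_mul n (fun _ => RtoC rho)); auto using expandable_const.
- intros z Hz; rewrite Cmod_mult, Cmod_R, Rabs_pos_eq by lra.
  specialize (H2 z Hz); pose proof (Cmod_ge_0 (g z)); nra.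
Qed.

(* Applying the strict case to [rho g] and letting [rho] tend to 1 gives
   [|g z - g 0| <= |z| |1 - conj (g 0) g z| = |z| |g z - g 0|]. *)
Lemma schur_unimodular (n : nat) (g : C -> C) :
  (3 <= n)%nat -> schur_function (S n) g -> Cmod (g 0) = 1%R ->
  forall z, in_disk z -> g z = g 0.
Proof.
intros Hn Hg Ha z Hz; set (a := g 0) in *.
assert (Hlim : forall rho, (0 <= rho < 1)%R ->
  (rho * Cmod (g z - a) <= Cmod z * (Cmod (g z - a) + 2 * (1 - rho)))%R).
{ intros rho Hr.
  destruct (schur_step_lt n (fun z => RtoC rho * g z)) as [g1 [[_ G1] G2]]; auto.
  - apply schur_scale; auto; lra.
  - fold a; rewrite Cmod_mult, Cmod_R, Ha, Rabs_pos_eq; lra.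
  - specialize (G2 z Hz); cbv beta in G2; fold a in G2.
    replace (RtoC rho * g z - RtoC rho * a) with (RtoC rho * (g z - a)) in G2 by ring.
    assert (E := f_equal Cmod G2).
    rewrite !Cmod_mult, Cmod_R, (Rabs_pos_eq rho) in E by lra.
    rewrite E, Rmult_assoc; apply Rmult_le_compat_l; [apply Cmod_ge_0|].
    assert (F : (Cmod (1 - Cconj (RtoC rho * a) * (RtoC rho * g z)) <=
                 Cmod (g z - a) + 2 * (1 - rho))%R).
    (* Uses [a * Cconj a = 1]. The second summand has modulus at most [1 - rho ^ 2], hence at most
       [2 * (1 - rho)]. *)
    { replace (1 - Cconj (RtoC rho * a) * (RtoC rho * g z))
        with (Cconj a * (a - g z) + RtoC (1 - rho ^ 2) * (Cconj a * g z)).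
      - eapply Rle_trans; [apply Cmod_triangle|].
        rewrite !Cmod_mult, Cmod_conj, Ha, Cmod_R, !Rmult_1_l.
        rewrite (Rabs_pos_eq (1 - rho ^ 2)) by nra.
        rewrite <- Cmod_opp; replace (- (a - g z)) with (g z - a) by ring.
        assert (B := proj2 Hg z Hz); pose proof (Cmod_ge_0 (g z)).
        assert (0 <= 1 - rho ^ 2 <= 2 * (1 - rho))%R by nra.
        apply Rplus_le_compat_l; nra.
      - rewrite Cmult_conj; replace (Cconj (RtoC rho)) with (RtoC rho)
          by (apply injective_projections; simpl; ring).
        assert (A1 := Cmod_conj_mult a); rewrite Ha, pow1 in A1.
        replace (Cconj a * (a - g z)) with (a * Cconj a - Cconj a * g z) by ring.
        rewrite A1, RtoC_minus, RtoC_pow; ring. }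
    specialize (G1 z Hz).
    pose proof (Cmod_ge_0 (g1 z)).
    pose proof (Cmod_ge_0 (1 - Cconj (RtoC rho * a) * (RtoC rho * g z))); nra. }
assert (Hle : (Cmod (g z - a) <= Cmod z * Cmod (g z - a))%R).
{ apply le_epsilon; intros e He.
  assert (P := Cmod_ge_0 (g z - a)).
  set (N := (Cmod (g z - a) + 2)%R) in *.
  assert (HN : (0 < N)%R) by (unfold N; lra).
  (* [t] plays the role of [1 - rho]: the inequality [Hlim] then exceeds its limit by at most
     [t * N], which is at most [e]. *)
  set (t := Rmin 1 (e / N)).
  assert (T0 : (0 < t)%R) by (apply Rmin_glb_lt; [lra|now apply Rdiv_lt_0_compat]).
  assert (T1 : (t <= 1)%R) by apply Rmin_l.
  assert (T2 : (t * N <= e)%R).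
  { apply Rle_trans with (e / N * N)%R; [|right; field; lra].
    apply Rmult_le_compat_r; [lra|apply Rmin_r]. }
  specialize (Hlim (1 - t)%R ltac:(lra)).
  unfold in_disk in Hz; pose proof (Cmod_ge_0 z); unfold N in T2; nra. }
assert (P := Cmod_ge_0 (g z - a)); unfold in_disk in Hz.
assert (E : Cmod (g z - a) = 0%R) by nra.
apply Cmod_eq_0 in E; replace (g z) with ((g z - a) + a) by ring; rewrite E; ring.
Qed.

(** When [|g 0| = 1] the function is constant, the left side of the identity vanishes, and [g1 = 0]
    serves. *)
Lemma schur_step (n : nat) (g : C -> C) :
  (3 <= n)%nat -> schur_function (S n) g ->
  exists g1, schur_function n g1 /\
    forall z, in_disk z -> g z - g 0 = z * g1 z * (1 - Cconj (g 0) * g z).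
Proof.
intros Hn Hg.
assert (D0 := in_disk_0).
destruct (Rle_lt_or_eq_dec _ _ (proj2 Hg 0 D0)) as [Hlt|Heq].
- now apply schur_step_lt.
- exists (fun _ => 0); split.
  + split; intros; [apply expandable_const|rewrite Cmod_0; lra].
  + intros z Hz; rewrite (schur_unimodular n g Hn Hg Heq z Hz); ring.
Qed.

(** * Complex power series *)

(** Fixes the algebraic structures once. Several lemmas below only restate general facts with the
    operations of [C], to which the generic ones are convertible. *)
Notation cseries := (@is_series C_AbsRing C_NormedModule).

Lemma cseries_unique (u : nat -> C) (l l' : C) : cseries u l -> cseries u l' -> l = l'.
Proof. exact (filterlim_locally_unique (K := C_AbsRing) (V := C_NormedModule) _ l l'). Qed.

Lemma cseries_add (u v : nat -> C) (l m : C) :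
  cseries u l -> cseries v m -> cseries (fun n => u n + v n) (l + m).
Proof. exact (is_series_plus (K := C_AbsRing) (V := C_NormedModule) u v l m). Qed.

Lemma cseries_sub (u v : nat -> C) (l m : C) :
  cseries u l -> cseries v m -> cseries (fun n => u n - v n) (l - m).
Proof. exact (is_series_minus (K := C_AbsRing) (V := C_NormedModule) u v l m). Qed.

Lemma cseries_scal (c : C) (u : nat -> C) (l : C) :
  cseries u l -> cseries (fun n => c * u n) (c * l).
Proof. exact (is_series_scal (K := C_AbsRing) (V := C_NormedModule) c u l). Qed.

Lemma cseries_ext (u v : nat -> C) (l : C) :
  (forall n, u n = v n) -> cseries u l -> cseries v l.
Proof. exact (is_series_ext (K := C_AbsRing) (V := C_NormedModule) u v l). Qed.

Lemma cseries_tail (u : nat -> C) (l : C) :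
  cseries u l -> cseries (fun n => u (S n)) (l - u 0%nat).
Proof.
intros H; apply (is_series_incr_1 (K := C_AbsRing) (V := C_NormedModule)).
assert (E : l = (l - u 0%nat) + u 0%nat) by ring; rewrite E in H; exact H.
Qed.

Lemma cseries_cons (u : nat -> C) (l : C) :
  cseries (fun n => u (S n)) l -> cseries u (u 0%nat + l).
Proof.
intros H; apply (is_series_decr_1 (K := C_AbsRing) (V := C_NormedModule)).
assert (E : l = (u 0%nat + l) - u 0%nat) by ring; rewrite E in H; exact H.
Qed.

Lemma cseries_Cmod_le (u : nat -> C) (b : nat -> R) (l : C) (B : R) :
  cseries u l -> (forall n, (Cmod (u n) <= b n)%R) -> is_series b B -> (Cmod l <= B)%R.
Proof.
intros Hu Hb HB.
assert (L : is_lim_seq (fun n => Cmod (sum_n (G := C_AbelianMonoid) u n)) (Finite (Cmod l)))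
  by exact (filterlim_comp _ _ _ _ _ _ _ _ Hu
             (filterlim_norm (K := C_AbsRing) (V := C_NormedModule) l)).
refine (is_lim_seq_le _ _ (Finite (Cmod l)) (Finite B) _ L HB).
intros n; eapply Rle_trans;
  [exact (norm_sum_n_m (K := C_AbsRing) (V := C_NormedModule) u 0 n)|].
apply sum_n_m_le; exact Hb.
Qed.

Lemma cseries_bounded (u : nat -> C) (l : C) :
  cseries u l -> exists M, forall n, (Cmod (u n) <= M)%R.
Proof.
intros H.
destruct (filterlim_bounded (K := C_AbsRing) (V := C_NormedModule)
            (sum_n (G := C_AbelianMonoid) u) (ex_intro _ l H)) as [M HM].
change (forall n, (Cmod (sum_n (G := C_AbelianMonoid) u n) <= M)%R) in HM.
exists (M + M)%R; intros [|n].
- assert (T := HM 0%nat); rewrite sum_O in T.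
  pose proof (Cmod_ge_0 (u 0%nat)); lra.
- assert (T1 := HM n); assert (T2 := HM (S n)); rewrite sum_Sn in T2.
  change (plus (sum_n (G := C_AbelianMonoid) u n) (u (S n)))
    with (sum_n (G := C_AbelianMonoid) u n + u (S n)) in T2.
  set (s := sum_n (G := C_AbelianMonoid) u n) in *.
  assert (T := Cmod_triangle (s + u (S n)) (- s)).
  replace (s + u (S n) + - s) with (u (S n)) in T by ring.
  rewrite Cmod_opp in T; lra.
Qed.

Lemma is_pseries_cseries (a : nat -> C) (z l : C) :
  @is_pseries C_AbsRing C_NormedModule a z l <-> cseries (fun n => z ^ n * a n) l.
Proof.
assert (E : forall n, @pow_n C_Ring z n = z ^ n)
  by (induction n as [|n IH]; simpl; [|rewrite IH]; reflexivity).
split; apply cseries_ext; intros n.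
- exact (f_equal (fun c => c * a n) (E n)).
- exact (f_equal (fun c => c * a n) (eq_sym (E n))).
Qed.

(* Radius of convergence at least 1. *)
Definition tame (a : nat -> C) : Prop :=
  forall r, (0 < r < 1)%R -> exists M, forall n, (Cmod (a n) * r ^ n <= M)%R.

Lemma tame_of_cseries (a : nat -> C) :
  (forall z, in_disk z -> exists l, cseries (fun n => z ^ n * a n) l) -> tame a.
Proof.
intros H r Hr; destruct (H (RtoC r)) as [l Hl].
- unfold in_disk; rewrite Cmod_R, Rabs_pos_eq; lra.
- destruct (cseries_bounded _ _ Hl) as [M HM]; exists M; intros n.
  specialize (HM n); rewrite Cmod_mult, Cmod_pow, Cmod_R, Rabs_pos_eq in HM; lra.
Qed.

(** Comparison with the geometric series of ratio [t / r], where [r] is halfway between [t] and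
    1. *)
Lemma tame_majorant (a : nat -> C) (t : R) :
  tame a -> (0 <= t < 1)%R -> exists B : R, is_series (fun n => (Cmod (a n) * t ^ n)%R) B.
Proof.
intros H Ht; set (r := ((1 + t) / 2)%R).
destruct (H r) as [M HM]; [unfold r; lra|].
assert (Hq : (0 <= t / r < 1)%R).
{ unfold r; split; [apply Rdiv_le_0_compat; lra|].
  apply Rlt_div_l; lra. }
apply (ex_series_le (K := R_AbsRing) (V := R_CompleteNormedModule) _
         (fun n => M * (t / r) ^ n)%R).
- intros n; change (norm (Cmod (a n) * t ^ n)%R) with (Rabs (Cmod (a n) * t ^ n)).
  assert (0 <= t ^ n)%R by (apply pow_le; lra).
  rewrite Rabs_pos_eq by (apply Rmult_le_pos; auto; apply Cmod_ge_0).
  assert (E : (t ^ n = r ^ n * (t / r) ^ n)%R).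
  { rewrite <- Rpow_mult_distr; f_equal; field; unfold r; lra. }
  rewrite E, <- Rmult_assoc; apply Rmult_le_compat_r; auto; apply pow_le; lra.
- apply (ex_series_scal (K := R_AbsRing) (V := R_NormedModule) M).
  apply ex_series_geom; rewrite Rabs_pos_eq; lra.
Qed.

Lemma tame_cseries (a : nat -> C) (z : C) :
  tame a -> in_disk z -> exists l, cseries (fun n => z ^ n * a n) l.
Proof.
intros H Hz; destruct (tame_majorant a (Cmod z) H) as [B HB].
{ split; [apply Cmod_ge_0|exact Hz]. }
apply (ex_series_le (K := C_AbsRing) (V := C_CompleteNormedModule) _
         (fun n => Cmod (a n) * Cmod z ^ n)%R).
- intros n; change (Cmod (z ^ n * a n) <= Cmod (a n) * Cmod z ^ n)%R.
  rewrite Cmod_mult, Cmod_pow; lra.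
- now exists B.
Qed.

(** Each of the [n] terms of [1 + t + ... + t ^ (n - 1) = (1 - t ^ n) / (1 - t)] is at least
    [t ^ n]. This controls the factors [n] that differentiation brings in. *)
Lemma pow_succ_mult_le (t : R) (n : nat) :
  (0 <= t < 1)%R -> (INR n * t ^ n * (1 - t) <= 1)%R.
Proof.
intros Ht.
enough (INR n * t ^ n * (1 - t) <= 1 - t ^ n)%R
  by (pose proof (pow_le t n ltac:(lra)); lra).
induction n as [|n IH]; [simpl; lra|].
rewrite S_INR; simpl pow.
assert (P := pow_le t n ltac:(lra)).
assert (P1 : (t ^ n <= 1)%R) by (rewrite <- (pow1 n); apply pow_incr; lra).
assert (0 <= (1 - t) * (1 - t ^ n))%R by (apply Rmult_le_pos; lra).
assert (t * (INR n * t ^ n * (1 - t)) <= t * (1 - t ^ n))%R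
  by (apply Rmult_le_compat_l; lra).
assert (0 <= t * t ^ n)%R by (apply Rmult_le_pos; lra).
nra.
Qed.

Lemma tame_INR (a : nat -> C) : tame a -> tame (fun n => RtoC (INR n) * a n).
Proof.
intros H r Hr; set (s := ((1 + r) / 2)%R).
destruct (H s) as [M HM]; [unfold s; lra|].
assert (Hq : (0 <= r / s < 1)%R).
{ unfold s; split; [apply Rdiv_le_0_compat; lra|apply Rlt_div_l; lra]. }
exists (M * / (1 - r / s))%R; intros n.
rewrite Cmod_mult, Cmod_R, Rabs_pos_eq by apply pos_INR.
assert (E : (r ^ n = s ^ n * (r / s) ^ n)%R).
{ rewrite <- Rpow_mult_distr; f_equal; field; unfold s; lra. }
rewrite E; replace (INR n * Cmod (a n) * (s ^ n * (r / s) ^ n))%R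
  with ((Cmod (a n) * s ^ n) * (INR n * (r / s) ^ n))%R by ring.
apply Rmult_le_compat; auto.
- apply Rmult_le_pos; [apply Cmod_ge_0|apply pow_le; unfold s; lra].
- apply Rmult_le_pos; [apply pos_INR|apply pow_le; lra].
- apply Rmult_le_reg_r with (1 - r / s)%R; [lra|].
  rewrite Rinv_l by lra; now apply pow_succ_mult_le.
Qed.

Lemma tame_shift (a : nat -> C) : tame a -> tame (fun n => a (S n)).
Proof.
intros H r Hr; destruct (H r Hr) as [M HM]; exists (M / r)%R; intros n.
apply Rmult_le_reg_r with r; [lra|].
replace (M / r * r)%R with M by (field; lra).
rewrite Rmult_assoc, (Rmult_comm _ r); exact (HM (S n)).
Qed.

(* Arbitrary where the series diverges. *)
Definition psum (a : nat -> C) (z : C) : C :=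
  epsilon (inhabits (RtoC 0)) (cseries (fun n => z ^ n * a n)).

Lemma psum_spec (a : nat -> C) (z : C) :
  tame a -> in_disk z -> cseries (fun n => z ^ n * a n) (psum a z).
Proof. intros Ha Hz; exact (epsilon_spec _ _ (tame_cseries a z Ha Hz)). Qed.

Lemma psum_unique (a : nat -> C) (z l : C) :
  tame a -> in_disk z -> cseries (fun n => z ^ n * a n) l -> psum a z = l.
Proof. intros Ha Hz; apply cseries_unique; now apply psum_spec. Qed.

Lemma psum_step (a : nat -> C) (z : C) :
  tame a -> in_disk z -> psum a z = a 0%nat + z * psum (fun n => a (S n)) z.
Proof.
intros Ha Hz; apply psum_unique; auto.
replace (a 0%nat) with (z ^ 0 * a 0%nat) by (simpl; ring).
apply (cseries_cons (fun n => z ^ n * a n)).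
eapply cseries_ext; [|apply (cseries_scal z); apply (psum_spec (fun n => a (S n)))];
  auto using tame_shift.
intros n; simpl; ring.
Qed.

Lemma psum_bounded (a : nat -> C) (z0 : C) :
  tame a -> in_disk z0 -> locally_bounded (fun h => psum a (z0 + h)).
Proof.
intros Ha Hz; unfold in_disk in Hz; assert (P := Cmod_ge_0 z0).
destruct (tame_majorant a ((1 + Cmod z0) / 2) Ha) as [B HB]; [lra|].
exists B; eapply near0_imp; [|exact (in_disk_near z0 ((1 + Cmod z0) / 2) ltac:(lra))].
intros h Hh; cbv beta in Hh.
eapply cseries_Cmod_le; [apply psum_spec; auto; unfold in_disk; lra| |exact HB].
intros n; cbv beta; rewrite Cmod_mult, Cmod_pow, Rmult_comm.
apply Rmult_le_compat_l; [apply Cmod_ge_0|].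
apply pow_incr; split; [apply Cmod_ge_0|lra].
Qed.

(** Shifted by one, these are the coefficients of the difference quotient of the series at [z].
    Re-expanding around [z] through them needs no interchange of double sums. *)
Definition tails (a : nat -> C) (z : C) (m : nat) : C :=
  psum (fun j => a (m + j)%nat) z.

Lemma tame_shift_n (a : nat -> C) (m : nat) : tame a -> tame (fun j => a (m + j)%nat).
Proof.
intros Ha; induction m as [|m IH]; auto.
intros r Hr; destruct (tame_shift _ IH r Hr) as [M HM]; exists M; intros n.
specialize (HM n); cbv beta in HM; now rewrite Nat.add_succ_r in HM.
Qed.

Lemma tails_step (a : nat -> C) (z : C) (m : nat) :
  tame a -> in_disk z -> tails a z m = a m + z * tails a z (S m).
Proof.
intros Ha Hz; unfold tails; rewrite psum_step by auto using tame_shift_n.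
rewrite Nat.add_0_r; f_equal; f_equal.
apply psum_unique; auto.
- apply (tame_shift (fun j => a (m + j)%nat)), tame_shift_n; auto.
- eapply cseries_ext; [|apply psum_spec; [apply (tame_shift_n a (S m))|]]; auto.
  intros n; cbv beta; now rewrite Nat.add_succ_r.
Qed.

Lemma tame_tails (a : nat -> C) (z : C) :
  tame a -> in_disk z -> tame (tails a z).
Proof.
intros Ha Hz r Hr; unfold in_disk in Hz; assert (P := Cmod_ge_0 z).
set (s := Rmax r ((1 + Cmod z) / 2)).
assert (S1 : (r <= s)%R) by apply Rmax_l.
assert (S2 : ((1 + Cmod z) / 2 <= s)%R) by apply Rmax_r.
assert (S3 : (s < 1)%R) by (apply Rmax_lub_lt; lra).
destruct (Ha s) as [M HM]; [lra|].
assert (Hq : (0 <= Cmod z / s < 1)%R).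
{ split; [apply Rdiv_le_0_compat; lra|apply Rlt_div_l; lra]. }
exists (M * / (1 - Cmod z / s))%R; intros m.
assert (HB : is_series (fun n => (M / s ^ m * (Cmod z / s) ^ n)%R)
               (M / s ^ m * / (1 - Cmod z / s))%R).
{ apply (is_series_scal (K := R_AbsRing) (V := R_NormedModule) (M / s ^ m)%R).
  apply is_series_geom; rewrite Rabs_pos_eq; lra. }
assert (Sp : forall n, (0 < s ^ n)%R) by (intros; apply pow_lt; lra).
assert (L : (Cmod (tails a z m) <= M / s ^ m * / (1 - Cmod z / s))%R).
{ eapply cseries_Cmod_le; [apply psum_spec; auto using tame_shift_n| |exact HB].
  intros n; cbv beta; rewrite Cmod_mult, Cmod_pow.
  assert (H := HM (m + n)%nat); rewrite pow_add in H.
  assert (Zp : (0 <= Cmod z ^ n)%R) by now apply pow_le.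
  unfold Rdiv; rewrite Rpow_mult_distr, pow_inv.
  apply Rmult_le_reg_r with (s ^ m * s ^ n)%R; [apply Rmult_lt_0_compat; auto|].
  replace (M * / s ^ m * (Cmod z ^ n * / s ^ n) * (s ^ m * s ^ n))%R
    with (M * Cmod z ^ n)%R.
  - replace (Cmod z ^ n * Cmod (a (m + n)%nat) * (s ^ m * s ^ n))%R
      with (Cmod (a (m + n)%nat) * (s ^ m * s ^ n) * Cmod z ^ n)%R by ring.
    now apply Rmult_le_compat_r.
  - field; split; apply Rgt_not_eq, Sp. }
apply Rle_trans with (Cmod (tails a z m) * s ^ m)%R.
- apply Rmult_le_compat_l; [apply Cmod_ge_0|apply pow_incr; lra].
- apply Rmult_le_reg_r with (/ s ^ m)%R; [apply Rinv_0_lt_compat; auto|].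
  rewrite Rmult_assoc, Rinv_r by (apply Rgt_not_eq, Sp).
  unfold Rdiv in L |- *; lra.
Qed.

(** Sum [a n = tails a z0 n - z0 * tails a z0 (S n)] against [z ^ n], then split the constant term
    off the first series. *)
Lemma psum_quotient (a : nat -> C) (z0 z : C) :
  tame a -> in_disk z0 -> in_disk z ->
  psum a z = psum a z0 + (z - z0) * psum (fun m => tails a z0 (S m)) z.
Proof.
intros Ha Hz0 Hz; assert (Ht := tame_tails a z0 Ha Hz0).
assert (E0 : psum a z0 = tails a z0 0) by reflexivity.
apply psum_unique; auto; rewrite E0.
assert (E1 := psum_step _ z Ht Hz).
replace (tails a z0 0 + (z - z0) * psum (fun m => tails a z0 (S m)) z)
  with (psum (tails a z0) z - z0 * psum (fun m => tails a z0 (S m)) z)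
  by (rewrite E1; ring).
eapply cseries_ext;
  [|apply cseries_sub; [apply psum_spec; auto|apply cseries_scal, psum_spec]];
  auto using tame_shift.
intros n; cbv beta; rewrite (tails_step a z0 n) by auto; ring.
Qed.

(** The difference quotient at [z0] is again a power series of radius at least 1, so the induction
    can continue with it. *)
Lemma psum_expandable (n : nat) (a : nat -> C) (z0 : C) :
  tame a -> in_disk z0 -> expandable n (fun h => psum a (z0 + h)).
Proof.
revert a; induction n as [|n IH]; intros a Ha Hz; [now apply psum_bounded|].
exists (psum a z0), (fun h => psum (fun m => tails a z0 (S m)) (z0 + h)); split.
- eapply near0_imp; [|exact (in_disk_near _ _ Hz)]; intros h Hh; cbv beta in Hh.
  rewrite (psum_quotient a z0) by auto; ring.
- apply IH; auto; now apply tame_shift, tame_tails.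
Qed.

(** * Termwise differentiation *)

Definition deriv_coeffs (a : nat -> C) (n : nat) : C := RtoC (INR (S n)) * a (S n).

Lemma tame_deriv_coeffs (a : nat -> C) : tame a -> tame (deriv_coeffs a).
Proof. intros Ha; exact (tame_shift _ (tame_INR _ Ha)). Qed.

(** The remainders satisfy [R (n + 1) = (z0 + h) * R n + n * h ^ 2 * z0 ^ (n - 1)], and
    [n ^ 2 + n <= (n + 1) ^ 2]. The factor [t ^ 2] on the left avoids the exponent [n - 2]. *)
Lemma pow_remainder_le (z0 h : C) (t : R) (n : nat) :
  (Cmod z0 <= t)%R -> (Cmod (z0 + h) <= t)%R ->
  (Cmod ((z0 + h) ^ n - z0 ^ n - h * (RtoC (INR n) * z0 ^ pred n)) * t ^ 2 <=
   INR n ^ 2 * t ^ n * Cmod h ^ 2)%R.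
Proof.
intros H0 H1; assert (P0 := Cmod_ge_0 z0); assert (Pt : (0 <= t)%R) by lra.
destruct n as [|n].
{ simpl; replace (1 - 1 - h * (0 * 1)) with (RtoC 0) by ring; rewrite Cmod_0; lra. }
induction n as [|n IH].
{ simpl; replace ((z0 + h) * 1 - z0 * 1 - h * (1 * 1)) with (RtoC 0) by ring.
  rewrite Cmod_0, Rmult_0_l.
  repeat apply Rmult_le_pos; try lra; apply Cmod_ge_0. }
set (R := (z0 + h) ^ S n - z0 ^ S n - h * (RtoC (INR (S n)) * z0 ^ pred (S n))) in IH.
replace ((z0 + h) ^ S (S n) - z0 ^ S (S n) - h * (RtoC (INR (S (S n))) * z0 ^ pred (S (S n))))
  with ((z0 + h) * R + RtoC (INR (S n)) * (h * h * z0 ^ n)).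
2:{ unfold R; rewrite (S_INR (S n)), RtoC_plus; simpl pred; simpl Cpow; ring. }
assert (A : (Cmod ((z0 + h) * R) <= t * Cmod R)%R)
  by (rewrite Cmod_mult; apply Rmult_le_compat_r; [apply Cmod_ge_0|auto]).
assert (B : (Cmod (RtoC (INR (S n)) * (h * h * z0 ^ n)) <=
             INR (S n) * (Cmod h ^ 2 * t ^ n))%R).
{ rewrite !Cmod_mult, Cmod_R, Cmod_pow, Rabs_pos_eq by apply pos_INR.
  apply Rmult_le_compat_l; [apply pos_INR|].
  replace (Cmod h ^ 2)%R with (Cmod h * Cmod h)%R by ring.
  apply Rmult_le_compat_l; [|apply pow_incr; lra].
  apply Rmult_le_pos; apply Cmod_ge_0. }
assert (T := Cmod_triangle ((z0 + h) * R) (RtoC (INR (S n)) * (h * h * z0 ^ n))).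
apply Rle_trans with ((t * Cmod R + INR (S n) * (Cmod h ^ 2 * t ^ n)) * t ^ 2)%R.
{ apply Rmult_le_compat_r; [apply pow2_ge_0|lra]. }
assert (IH' := Rmult_le_compat_l t _ _ Pt IH).
rewrite (S_INR (S n)).
assert (N := pos_INR (S n)); set (N0 := INR (S n)) in *.
assert (Q : (0 <= Cmod h ^ 2 * t ^ n * t ^ 2)%R).
{ repeat apply Rmult_le_pos; try lra; auto using pow_le; apply Cmod_ge_0. }
assert (Q1 : (0 <= N0 * (Cmod h ^ 2 * t ^ n * t ^ 2))%R) by now apply Rmult_le_pos.
simpl pow in *; nra.
Qed.

Lemma psum_remainder (a : nat -> C) (z0 : C) :
  tame a -> in_disk z0 ->
  exists K, near0 (fun h =>
    (Cmod (psum a (z0 + h) - psum a z0 - h * psum (deriv_coeffs a) z0) <= K * Cmod h ^ 2)%R).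
Proof.
intros Ha Hz; assert (Hz' := Hz); unfold in_disk in Hz'; assert (P := Cmod_ge_0 z0).
set (t := ((1 + Cmod z0) / 2)%R).
assert (Ht : (0 < t < 1)%R) by (unfold t; lra).
(* Two factors [n], for the [n ^ 2] in [pow_remainder_le]. *)
assert (Ha2 := tame_INR _ (tame_INR _ Ha)).
destruct (tame_majorant _ t Ha2) as [B HB]; [lra|].
exists (B / t ^ 2)%R; eapply near0_imp; [|exact (in_disk_near z0 t ltac:(unfold t; lra))].
intros h Hh; cbv beta in Hh.
assert (Hzh : in_disk (z0 + h)) by (unfold in_disk; lra).
assert (D : cseries (fun n => RtoC (INR n) * z0 ^ pred n * a n) (psum (deriv_coeffs a) z0)).
{ replace (psum (deriv_coeffs a) z0)
    with (RtoC (INR 0) * z0 ^ pred 0 * a 0%nat + psum (deriv_coeffs a) z0)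
    by (simpl; ring).
  apply (cseries_cons (fun n => RtoC (INR n) * z0 ^ pred n * a n)).
  eapply cseries_ext; [|apply psum_spec; auto using tame_deriv_coeffs].
  intros n; unfold deriv_coeffs; simpl pred; ring. }
assert (E := cseries_sub _ _ _ _
  (cseries_sub _ _ _ _ (psum_spec a _ Ha Hzh) (psum_spec a _ Ha Hz)) (cseries_scal h _ _ D)).
assert (HB' : is_series (fun n => (Cmod h ^ 2 / t ^ 2 *
    (Cmod (RtoC (INR n) * (RtoC (INR n) * a n)) * t ^ n))%R) (Cmod h ^ 2 / t ^ 2 * B)%R)
  by exact (is_series_scal (K := R_AbsRing) (V := R_NormedModule) _ _ _ HB).
apply Rle_trans with (Cmod h ^ 2 / t ^ 2 * B)%R; [|right; field; lra].
eapply cseries_Cmod_le; [exact E| |exact HB'].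
intros n; cbv beta.
replace ((z0 + h) ^ n * a n - z0 ^ n * a n - h * (RtoC (INR n) * z0 ^ pred n * a n))
  with (((z0 + h) ^ n - z0 ^ n - h * (RtoC (INR n) * z0 ^ pred n)) * a n) by ring.
assert (L := pow_remainder_le z0 h t n ltac:(unfold t; lra) ltac:(lra)).
rewrite !Cmod_mult, Cmod_R, Rabs_pos_eq by apply pos_INR.
set (A := Cmod ((z0 + h) ^ n - z0 ^ n - h * (RtoC (INR n) * z0 ^ pred n))) in *.
assert (T2 : (0 < t ^ 2)%R) by (apply pow_lt; lra).
apply Rmult_le_reg_r with (t ^ 2)%R; auto.
replace (Cmod h ^ 2 / t ^ 2 * (INR n * (INR n * Cmod (a n)) * t ^ n) * t ^ 2)%R
  with (INR n ^ 2 * t ^ n * Cmod h ^ 2 * Cmod (a n))%R by (field; lra).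
replace (A * Cmod (a n) * t ^ 2)%R with (A * t ^ 2 * Cmod (a n))%R by ring.
apply Rmult_le_compat_r; [apply Cmod_ge_0|exact L].
Qed.

(** * The extremal problem in Schur parameters *)

(* The difference of the two sides, here and in the next lemma, has a Bernstein expansion
   in [q] and [t] with nonnegative coefficients. *)
Lemma bernstein_bound_one (q t : R) :
  (0 <= q <= 1)%R -> (0 <= t <= 1)%R ->
  let s := (1 - q)%R in let X := (1 - t ^ 2)%R in
  (14 * q ^ 3 + 84 * q ^ 2 * s * t + (192 * q ^ 2 * s + 408 * q * s ^ 2) * t ^ 2
   + (224 * s ^ 3 + 192 * q * s ^ 2 + 288 * q ^ 2 * s) * t ^ 3 + 192 * s ^ 2 * q * t ^ 4
   + s * X * (384 * s * t ^ 2 + (192 * s + 576 * q) * ((q + t ^ 2) / 2) + 192 * q)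
   + (960 * s ^ 2 * X ^ 2 + 288 * (4 * s * t + q) * s * X * t) <= 960)%R.
Proof.
intros Hq Ht s X; unfold X; set (v := (1 - t)%R).
assert (Hs : (0 <= s)%R) by (unfold s; lra).
assert (Hv : (0 <= v)%R) by (unfold v; lra).
(* The coefficient of [s ^ 3 * v ^ 4] is zero because the bound is attained at [q = t = 0], the
   extremal case. *)
assert (Hp : (0 <=
   s ^ 3 * (288 * t ^ 2 * v ^ 2 + 352 * t ^ 3 * v + 736 * t ^ 4)
 + q * s ^ 2 * (1632 * v ^ 4 + 6240 * t * v ^ 3 + 8808 * t ^ 2 * v ^ 2
     + 5520 * t ^ 3 * v + 2088 * t ^ 4)
 + q ^ 2 * s * (2400 * v ^ 4 + 9228 * t * v ^ 3 + 13284 * t ^ 2 * v ^ 2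
     + 8484 * t ^ 3 * v + 2316 * t ^ 4)
 + q ^ 3 * (946 * v ^ 4 + 3784 * t * v ^ 3 + 5676 * t ^ 2 * v ^ 2
     + 3784 * t ^ 3 * v + 946 * t ^ 4))%R)
  by (repeat first [lra | apply pow_le | apply Rmult_le_pos | apply Rplus_le_le_0_compat]).
unfold v, s in Hp |- *; ring_simplify in Hp; ring_simplify; lra.
Qed.

Lemma bernstein_bound_zero (q t : R) :
  (0 <= q <= 1)%R -> (0 <= t <= 1)%R ->
  let s := (1 - q)%R in let X := (1 - t ^ 2)%R in
  (14 * q ^ 3 + 84 * q ^ 2 * s * t + (192 * q ^ 2 * s + 408 * q * s ^ 2) * t ^ 2
   + (224 * s ^ 3 + 192 * q * s ^ 2 + 288 * q ^ 2 * s) * t ^ 3 + 192 * s ^ 2 * q * t ^ 4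
   + s * X * (384 * s * t ^ 2 + (192 * s + 576 * q) * ((q + t ^ 2) / 2) + 192 * q)
   + 288 * (4 * s * t + q) * s * X <= 960)%R.
Proof.
intros Hq Ht s X; unfold X; set (v := (1 - t)%R).
assert (Hs : (0 <= s)%R) by (unfold s; lra).
assert (Hv : (0 <= v)%R) by (unfold v; lra).
assert (Hp : (0 <=
   s ^ 3 * (960 * v ^ 4 + 2688 * t * v ^ 3 + 1824 * t ^ 2 * v ^ 2 + 352 * t ^ 3 * v
     + 736 * t ^ 4)
 + q * s ^ 2 * (2304 * v ^ 4 + 8064 * t * v ^ 3 + 9768 * t ^ 2 * v ^ 2
     + 5520 * t ^ 3 * v + 2088 * t ^ 4)
 + q ^ 2 * s * (2112 * v ^ 4 + 8364 * t * v ^ 3 + 12708 * t ^ 2 * v ^ 2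
     + 8484 * t ^ 3 * v + 2316 * t ^ 4)
 + q ^ 3 * (946 * v ^ 4 + 3784 * t * v ^ 3 + 5676 * t ^ 2 * v ^ 2
     + 3784 * t ^ 3 * v + 946 * t ^ 4))%R)
  by (repeat first [lra | apply pow_le | apply Rmult_le_pos | apply Rplus_le_le_0_compat]).
unfold v, s in Hp |- *; ring_simplify in Hp; ring_simplify; lra.
Qed.

(* Bounding [r] by 1 in the linear term, and [c t] by [(c ^ 2 + t ^ 2) / 2], makes the
   left-hand side affine in [r ^ 2]. *)
Lemma schur_parameter_bound (c t r : R) :
  (0 <= c <= 1)%R -> (0 <= t <= 1)%R -> (0 <= r <= 1)%R ->
  let q := (c ^ 2)%R in let s := (1 - q)%R in let X := (1 - t ^ 2)%R in
  (14 * c ^ 6 + 84 * c ^ 4 * s * t + (192 * q * c ^ 2 * s + 408 * c ^ 2 * s ^ 2) * t ^ 2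
   + (224 * s ^ 3 + 192 * q * s ^ 2 + 288 * q ^ 2 * s) * t ^ 3 + 192 * s ^ 2 * c ^ 2 * t ^ 4
   + s * X * (384 * s * c * t ^ 2 + (192 * s + 576 * q) * c * t + 192 * c ^ 3) * r
   + (960 * s ^ 2 * X ^ 2 + 288 * (4 * s * t + c ^ 2) * s * X * t) * r ^ 2
   + 288 * (4 * s * t + c ^ 2) * s * X * (1 - r ^ 2) <= 960)%R.
Proof.
intros Hc Ht Hr q s X.
assert (Hq : (0 <= q <= 1)%R) by (unfold q; nra).
assert (H1 := bernstein_bound_one q t Hq Ht); assert (H0 := bernstein_bound_zero q t Hq Ht).
cbv zeta in H0, H1; fold s in H0, H1; fold X in H0, H1.
replace (14 * c ^ 6)%R with (14 * q ^ 3)%R by (unfold q; ring).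
replace (84 * c ^ 4 * s * t)%R with (84 * q ^ 2 * s * t)%R by (unfold q; ring).
replace (192 * q * c ^ 2 * s + 408 * c ^ 2 * s ^ 2)%R
  with (192 * q ^ 2 * s + 408 * q * s ^ 2)%R by (unfold q; ring).
replace (192 * c ^ 3)%R with (192 * (q * c))%R by (unfold q; ring).
fold q.
assert (Hs : (0 <= s)%R) by (unfold s; lra).
assert (HX : (0 <= X)%R) by (unfold X; nra).
assert (B1 : (384 * s * c * t ^ 2 <= 384 * s * t ^ 2)%R).
{ assert (0 <= s * t ^ 2)%R by (apply Rmult_le_pos; auto; apply pow2_ge_0). nra. }
assert (B2 : ((192 * s + 576 * q) * c * t <= (192 * s + 576 * q) * ((q + t ^ 2) / 2))%R).
{ rewrite Rmult_assoc; apply Rmult_le_compat_l; [lra|].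
  unfold q; pose proof (pow2_ge_0 (c - t)); nra. }
assert (B3 : (192 * (q * c) <= 192 * q)%R) by nra.
set (b := (384 * s * t ^ 2 + (192 * s + 576 * q) * ((q + t ^ 2) / 2) + 192 * q)%R) in *.
assert (Hb : (s * X * (384 * s * c * t ^ 2 + (192 * s + 576 * q) * c * t + 192 * (q * c)) * r
              <= s * X * b)%R).
{ rewrite Rmult_assoc; apply Rmult_le_compat_l; [now apply Rmult_le_pos|].
  set (b0 := (384 * s * c * t ^ 2 + (192 * s + 576 * q) * c * t + 192 * (q * c))%R) in *.
  assert (0 <= b0)%R.
  { unfold b0; repeat first [lra | apply pow_le | apply Rmult_le_pos | apply Rplus_le_le_0_compat]. }
  assert (b0 <= b)%R by (unfold b0, b; lra).
  nra. }
set (A := (14 * q ^ 3 + 84 * q ^ 2 * s * t + (192 * q ^ 2 * s + 408 * q * s ^ 2) * t ^ 2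
   + (224 * s ^ 3 + 192 * q * s ^ 2 + 288 * q ^ 2 * s) * t ^ 3 + 192 * s ^ 2 * q * t ^ 4)%R) in *.
set (E := (960 * s ^ 2 * X ^ 2 + 288 * (4 * s * t + q) * s * X * t)%R) in *.
set (D := (288 * (4 * s * t + q) * s * X)%R) in *.
assert (Hr2 : (0 <= r ^ 2 <= 1)%R) by nra.
set (p := (r ^ 2)%R) in *.
apply Rle_trans with (A + s * X * b + E * p + D * (1 - p))%R; [lra|].
(* An affine function of [p] on the unit interval is a convex combination of its values at 1 and 0,
   which the two Bernstein bounds control. *)
replace (A + s * X * b + E * p + D * (1 - p))%R
  with (p * (A + s * X * b + E) + (1 - p) * (A + s * X * b + D))%R by ring.
assert (p * (A + s * X * b + E) <= p * 960)%R by (apply Rmult_le_compat_l; lra).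
assert ((1 - p) * (A + s * X * b + D) <= (1 - p) * 960)%R by (apply Rmult_le_compat_l; lra).
lra.
Qed.

Lemma Cmod_IZR_mult (n : Z) (z : C) :
  (0 <= IZR n)%R -> Cmod (RtoC (IZR n) * z) = (IZR n * Cmod z)%R.
Proof. intros H; rewrite Cmod_mult, Cmod_R, Rabs_pos_eq; auto. Qed.

(** This is [1 - |a| ^ 2], written as a polynomial in [a] and [Cconj a] so that [ring] can expand
    it. *)
Definition defect (a : C) : C := 1 - a * Cconj a.

Lemma Cmod_defect (a : C) : (Cmod a <= 1)%R -> Cmod (defect a) = (1 - Cmod a ^ 2)%R.
Proof.
intros H; unfold defect.
rewrite Cmod_conj_mult, <- RtoC_minus, Cmod_R; apply Rabs_pos_eq.
pose proof (Cmod_ge_0 a); nra.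
Qed.

(** One rule per operation, with the bounds as parameters: applied repeatedly, they synthesize the
    triangle-inequality bound of a polynomial from its shape. *)
Lemma Cmod_add_le (a b : C) (A B : R) :
  (Cmod a <= A)%R -> (Cmod b <= B)%R -> (Cmod (a + b) <= A + B)%R.
Proof. intros; eapply Rle_trans; [apply Cmod_triangle|lra]. Qed.

Lemma Cmod_sub_le (a b : C) (A B : R) :
  (Cmod a <= A)%R -> (Cmod b <= B)%R -> (Cmod (a - b) <= A + B)%R.
Proof. intros; eapply Rle_trans; [apply Cmod_triangle|rewrite Cmod_opp; lra]. Qed.

Lemma Cmod_mul_le (a b : C) (A B : R) :
  (Cmod a <= A)%R -> (Cmod b <= B)%R -> (Cmod (a * b) <= A * B)%R.
Proof. intros; rewrite Cmod_mult; apply Rmult_le_compat; auto using Cmod_ge_0. Qed.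

Lemma Cmod_pow_le (a : C) (A : R) (n : nat) :
  (Cmod a <= A)%R -> (Cmod (a ^ n) <= A ^ n)%R.
Proof. intros; rewrite Cmod_pow; apply pow_incr; auto using Cmod_ge_0. Qed.

Lemma Cmod_IZR_le (n : Z) : (0 <= IZR n)%R -> (Cmod (RtoC (IZR n)) <= IZR n)%R.
Proof. intros H; rewrite Cmod_R, Rabs_pos_eq; lra. Qed.

(** Here [w z = c z + c2 z ^ 2 + c3 z ^ 3 + c4 z ^ 4 + ...], and [c, x, y, u] are its Schur
    parameters. *)
Lemma hankel3_schur_bound (c x y u c2 c3 c4 : C) (a : nat -> C) :
  (Cmod c <= 1)%R -> (Cmod x <= 1)%R -> (Cmod y <= 1)%R -> (Cmod u <= 1)%R ->
  c2 = x * defect c ->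
  c3 = y * defect x * defect c - x * Cconj c * c2 ->
  c4 = (u * defect y * defect x - y * Cconj x * (y * defect x)) * defect c
       - y * defect x * Cconj c * c2 - x * Cconj c * c3 ->
  2 * a 2%nat = c ->
  24 * a 3%nat = 4 * c2 + 5 * c ^ 2 ->
  96 * a 4%nat = 8 * c3 + 16 * c * c2 + 7 * c ^ 3 ->
  1920 * a 5%nat = 96 * c4 + 176 * c * c3 + 72 * c2 ^ 2 + 184 * c ^ 2 * c2 + 43 * c ^ 4 ->
  (Cmod (hankel3 a) <= 1 / 144)%R.
Proof.
intros Hc Hx Hy Hu E2 E3 E4 A2 A3 A4 A5.
assert (K : 138240 * hankel3 a =
   60 * (24 * a 3%nat) * (2 * a 2%nat) * (96 * a 4%nat) - 10 * (24 * a 3%nat) ^ 3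
   - 15 * (96 * a 4%nat) ^ 2 + 3 * (1920 * a 5%nat) * (24 * a 3%nat)
   - 18 * (1920 * a 5%nat) * (2 * a 2%nat) ^ 2)
  by (rewrite hankel3E; ring).
rewrite A2, A3, A4, A5, E4, E3, E2 in K.
set (s := defect c) in *; set (X := defect x) in *; set (Y := defect y) in *.
set (q := c * Cconj c).
(* Collected by powers of [y] and [u]. Relations such as [q = 1 - s] allow many equivalent forms;
   this one is chosen so that taking moduli term by term gives the left side of
   [schur_parameter_bound]. *)
assert (K' : 138240 * hankel3 a =
    84 * c ^ 4 * s * x - 14 * c ^ 6
    - (192 * q * c ^ 2 * s + 408 * c ^ 2 * s ^ 2) * x ^ 2
    + (224 * s ^ 3 - 192 * q * s ^ 2 - 288 * q ^ 2 * s) * x ^ 3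
    + 192 * s ^ 2 * Cconj c ^ 2 * x ^ 4
    + s * X * ((192 * s + 576 * q) * c * x - 384 * s * Cconj c * x ^ 2 + 192 * c ^ 3) * y
    - (960 * s ^ 2 * X ^ 2 + 288 * (4 * s * x - c ^ 2) * s * X * Cconj x) * y ^ 2
    + 288 * (4 * s * x - c ^ 2) * s * X * Y * u).
{ rewrite K; unfold q, s, X, Y, defect; ring. }
clear K.
assert (Ms : Cmod s = (1 - Cmod c ^ 2)%R) by now apply Cmod_defect.
assert (MX : Cmod X = (1 - Cmod x ^ 2)%R) by now apply Cmod_defect.
assert (MY : Cmod Y = (1 - Cmod y ^ 2)%R) by now apply Cmod_defect.
assert (Mq : Cmod q = (Cmod c ^ 2)%R)
  by (unfold q; rewrite Cmod_mult, Cmod_conj; ring).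
assert (P := schur_parameter_bound (Cmod c) (Cmod x) (Cmod y)
  (conj (Cmod_ge_0 c) Hc) (conj (Cmod_ge_0 x) Hx) (conj (Cmod_ge_0 y) Hy)).
cbv zeta in P; rewrite <- Ms, <- MX, <- MY in P.
assert (M := f_equal Cmod K').
rewrite Cmod_IZR_mult in M by lra.
match type of M with _ = Cmod ?rhs => assert (L : (Cmod rhs <= 960)%R) end; [|lra].
clear M K'.
clearbody q s X Y.
eapply Rle_trans.
(* Only [u] is replaced by the bound 1; every other variable keeps its own modulus. *)
- repeat first [exact Hu | eapply Cmod_sub_le | eapply Cmod_add_le | eapply Cmod_pow_le
    | eapply Cmod_mul_le | (apply Cmod_IZR_le; lra) | apply Rle_refl].
- refine (Rle_trans _ _ _ _ P).
  rewrite !Cmod_conj, Mq, MY; right; ring.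
Qed.

(** * Taylor coefficients *)

(** Five coefficients suffice: [a 5] enters the differential equation through the coefficient of
    [z ^ 4]. *)
Definition has_jet (g : C -> C) (e0 e1 e2 e3 e4 : C) : Prop :=
  exists r, locally_bounded r /\
    near0 (fun h => g h = e0 + h * (e1 + h * (e2 + h * (e3 + h * (e4 + h * r h))))).

Lemma expandable_has_jet (g : C -> C) :
  expandable 5 g -> exists e0 e1 e2 e3 e4, has_jet g e0 e1 e2 e3 e4.
Proof.
intros (e0 & g1 & H0 & e1 & g2 & H1 & e2 & g3 & H2 & e3 & g4 & H3 & e4 & r & H4 & Hr).
exists e0, e1, e2, e3, e4, r; split; auto.
eapply near0_imp;
  [|exact (near0_and _ _ H0 (near0_and _ _ H1 (near0_and _ _ H2 (near0_and _ _ H3 H4))))].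
now intros h (-> & -> & -> & -> & ->).
Qed.

(** Letting [h] tend to 0 gives [c = 0], and then [h] can be cancelled. Cancellation says nothing at
    [h = 0], so that point is excluded in hypothesis and conclusion alike and the lemma can be
    iterated. *)
Lemma near0_affine_zero (c : C) (r : C -> C) :
  locally_bounded r -> near0 (fun h => h <> 0 -> c + h * r h = 0) ->
  c = 0 /\ near0 (fun h => h <> 0 -> r h = 0).
Proof.
intros [K HK] H.
assert (Hc : c = 0).
{ apply Cmod_eq_0, Rle_antisym; [|apply Cmod_ge_0].
  apply le_epsilon; intros e He; rewrite Rplus_0_l.
  assert (K0 : (0 <= K)%R)
    by (eapply Rle_trans; [apply Cmod_ge_0|exact (near0_at0 _ HK)]).
  destruct (near0_and _ _ HK H) as [d [Hd HH]].
  set (t := Rmin (d / 2) (e / (K + 1))).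
  assert (T0 : (0 < t)%R) by (apply Rmin_glb_lt; [lra|apply Rdiv_lt_0_compat; lra]).
  assert (T1 : (t <= d / 2)%R) by apply Rmin_l.
  assert (T2 : (t * (K + 1) <= e)%R).
  { apply Rle_trans with (e / (K + 1) * (K + 1))%R; [|right; field; lra].
    apply Rmult_le_compat_r; [lra|apply Rmin_r]. }
  assert (Mt : Cmod (RtoC t) = t) by (rewrite Cmod_R; apply Rabs_pos_eq; lra).
  destruct (HH (RtoC t)) as [A B]; [lra|].
  assert (Hn : RtoC t <> 0) by (intros E; rewrite E, Cmod_0 in Mt; lra).
  specialize (B Hn).
  replace c with (- (RtoC t * r (RtoC t))).
  - rewrite Cmod_opp, Cmod_mult, Mt; nra.
  - replace c with ((c + RtoC t * r (RtoC t)) - RtoC t * r (RtoC t)) by ring.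
    rewrite B; ring. }
split; auto.
eapply near0_imp; [|exact H]; intros h Hh Hn; cbv beta in Hh.
specialize (Hh Hn); rewrite Hc, Cplus_0_l in Hh.
replace (r h) with (/ h * (h * r h)) by (field; auto).
rewrite Hh; ring.
Qed.

Lemma locally_bounded_affine (c : C) (r : C -> C) :
  locally_bounded r -> locally_bounded (fun h => c + h * r h).
Proof.
intros H; apply (expandable_add 0 (fun _ => c)); [apply (expandable_const 0)|].
apply (expandable_mul 0 (fun h => h)); [apply (expandable_id 0)|exact H].
Qed.

Lemma has_jet_unique (g k : C -> C) (e0 e1 e2 e3 e4 f0 f1 f2 f3 f4 : C) :
  near0 (fun h => g h = k h) -> has_jet g e0 e1 e2 e3 e4 -> has_jet k f0 f1 f2 f3 f4 ->
  e0 = f0 /\ e1 = f1 /\ e2 = f2 /\ e3 = f3 /\ e4 = f4.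
Proof.
intros E [r [Hr Gr]] [s [Hs Gs]].
assert (B5 : locally_bounded (fun h => r h - s h)) by now apply (expandable_sub 0).
assert (B4 := locally_bounded_affine (e4 - f4) _ B5).
assert (B3 := locally_bounded_affine (e3 - f3) _ B4).
assert (B2 := locally_bounded_affine (e2 - f2) _ B3).
assert (B1 := locally_bounded_affine (e1 - f1) _ B2).
assert (Z : forall a b : C, a - b = 0 -> a = b)
  by (intros a b H; replace a with ((a - b) + b) by ring; rewrite H; ring).
destruct (near0_affine_zero (e0 - f0) _ B1) as [Z0 N1].
{ eapply near0_imp; [|exact (near0_and _ _ E (near0_and _ _ Gr Gs))].
  intros h (E0 & E1 & E2) _; rewrite E1, E2 in E0.
  match type of E0 with ?A = ?B => replace (RtoC 0) with (A - B) by (rewrite E0; ring) end.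
  ring. }
destruct (near0_affine_zero _ _ B2 N1) as [Z1 N2].
destruct (near0_affine_zero _ _ B3 N2) as [Z2 N3].
destruct (near0_affine_zero _ _ B4 N3) as [Z3 N4].
destruct (near0_affine_zero _ _ B5 N4) as [Z4 _].
repeat split; auto.
Qed.

Lemma has_jet_const (c : C) : has_jet (fun _ => c) c 0 0 0 0.
Proof.
exists (fun _ => 0); split; [apply (expandable_const 0)|].
apply near0_all; intros; ring.
Qed.

Lemma has_jet_id : has_jet (fun h => h) 0 1 0 0 0.
Proof.
exists (fun _ => 0); split; [apply (expandable_const 0)|].
apply near0_all; intros; ring.
Qed.

Lemma has_jet_add (g k : C -> C) (e0 e1 e2 e3 e4 f0 f1 f2 f3 f4 : C) :
  has_jet g e0 e1 e2 e3 e4 -> has_jet k f0 f1 f2 f3 f4 ->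
  has_jet (fun h => g h + k h) (e0 + f0) (e1 + f1) (e2 + f2) (e3 + f3) (e4 + f4).
Proof.
intros [r [Hr Gr]] [s [Hs Gs]]; exists (fun h => r h + s h); split.
- now apply (expandable_add 0).
- eapply near0_imp; [|exact (near0_and _ _ Gr Gs)]; intros h [-> ->]; ring.
Qed.

Lemma has_jet_sub (g k : C -> C) (e0 e1 e2 e3 e4 f0 f1 f2 f3 f4 : C) :
  has_jet g e0 e1 e2 e3 e4 -> has_jet k f0 f1 f2 f3 f4 ->
  has_jet (fun h => g h - k h) (e0 - f0) (e1 - f1) (e2 - f2) (e3 - f3) (e4 - f4).
Proof.
intros [r [Hr Gr]] [s [Hs Gs]]; exists (fun h => r h - s h); split.
- now apply (expandable_sub 0).
- eapply near0_imp; [|exact (near0_and _ _ Gr Gs)]; intros h [-> ->]; ring.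
Qed.

Lemma has_jet_mul (g k : C -> C) (e0 e1 e2 e3 e4 f0 f1 f2 f3 f4 : C) :
  has_jet g e0 e1 e2 e3 e4 -> has_jet k f0 f1 f2 f3 f4 ->
  has_jet (fun h => g h * k h)
    (e0 * f0) (e0 * f1 + e1 * f0) (e0 * f2 + e1 * f1 + e2 * f0)
    (e0 * f3 + e1 * f2 + e2 * f1 + e3 * f0)
    (e0 * f4 + e1 * f3 + e2 * f2 + e3 * f1 + e4 * f0).
Proof.
intros [r [Hr Gr]] [s [Hs Gs]].
assert (Bc := fun c : C => expandable_const 0 c : locally_bounded (fun _ => c)).
assert (BP := fun c d p q : C => locally_bounded_affine c _ (locally_bounded_affine d _
  (locally_bounded_affine p _ (Bc q)))).
(* The terms of degree 5 to 8 in the product of the two Taylor polynomials, divided by [h ^ 5]. *)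
set (rest := fun h => (e1 * f4 + e2 * f3 + e3 * f2 + e4 * f1)
  + h * ((e2 * f4 + e3 * f3 + e4 * f2) + h * ((e3 * f4 + e4 * f3) + h * (e4 * f4)))).
set (P := fun h => e0 + h * (e1 + h * (e2 + h * (e3 + h * e4)))).
set (Q := fun h => f0 + h * (f1 + h * (f2 + h * (f3 + h * (f4 + h * s h))))).
exists (fun h => rest h + (r h * Q h + P h * s h)); split.
- apply (expandable_add 0 rest); [apply BP|].
  apply (expandable_add 0 (fun h => r h * Q h)).
  + apply (expandable_mul 0 r); auto.
    unfold Q; apply locally_bounded_affine; do 4 apply locally_bounded_affine; auto.
  + apply (expandable_mul 0 P); auto.
    unfold P; apply locally_bounded_affine, BP.
- eapply near0_imp; [|exact (near0_and _ _ Gr Gs)]; intros h [-> ->].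
  unfold rest, P, Q; ring.
Qed.

Lemma psum_has_jet (a : nat -> C) :
  tame a -> has_jet (psum a) (a 0%nat) (a 1%nat) (a 2%nat) (a 3%nat) (a 4%nat).
Proof.
intros Ha.
assert (H1 := tame_shift _ Ha); assert (H2 := tame_shift _ H1).
assert (H3 := tame_shift _ H2); assert (H4 := tame_shift _ H3).
assert (D0 := in_disk_0).
exists (psum (fun n => a (S (S (S (S (S n))))))); split.
- apply (expandable_ext 0 (fun h => psum (fun n => a (S (S (S (S (S n)))))) (0 + h))).
  + apply near0_all; intros h; now rewrite Cplus_0_l.
  + apply psum_bounded; [exact (tame_shift _ H4)|exact D0].
- eapply near0_imp; [|exact (near0_ball 1 Rlt_0_1)]; intros h Hh.
  rewrite (psum_step a), (psum_step _ h H1), (psum_step _ h H2), (psum_step _ h H3),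
    (psum_step _ h H4) by auto; reflexivity.
Qed.

(** * Derivatives of power series, regularity of the Schwarz function *)

Lemma is_derive_of_remainder (f : C -> C) (z l : C) (K : R) :
  near0 (fun h => (Cmod (f (z + h)%C - f z - h * l) <= K * Cmod h ^ 2)%R) ->
  @is_derive C_AbsRing C_NormedModule f z l.
Proof.
intros H; split.
- apply is_linear_scal_l.
- intros x Hx.
  assert (E : z = x)
    by exact (is_filter_lim_locally_unique (K := C_AbsRing)
               (V := AbsRing_NormedModule C_AbsRing) z x Hx).
  rewrite <- E; intros eps.
  assert (He : (0 < eps / (Rabs K + 1))%R).
  { apply Rdiv_lt_0_compat; [apply cond_pos|pose proof (Rabs_pos K); lra]. }
  destruct (near0_and _ _ H (near0_ball _ He)) as [d [Hd HH]].
  exists (mkposreal d Hd); intros y Hy.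
  change (Cmod (y - z) < d)%R in Hy.
  change (Cmod (f y - f z - (y - z) * l) <= eps * Cmod (y - z))%R.
  assert (E0 : forall c : C, z + (c - z) = c) by (intros; ring).
  destruct (HH (y - z) Hy) as [A B]; rewrite E0 in A.
  eapply Rle_trans; [exact A|].
  assert (P := Cmod_ge_0 (y - z)).
  assert (L : (Cmod (y - z) * (Rabs K + 1) <= eps)%R).
  { pose proof (Rabs_pos K).
    apply Rle_trans with (eps / (Rabs K + 1) * (Rabs K + 1))%R;
      [apply Rmult_le_compat_r; lra|right; field; lra]. }
  pose proof (Rle_abs K); nra.
Qed.

(** Agreement is asked only on the disk, since [f] is arbitrary outside. The lemma therefore also
    applies to [C_derive f], which gives the second derivative. *)
Lemma is_derive_psum (f : C -> C) (a : nat -> C) (z : C) :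
  tame a -> (forall y, in_disk y -> f y = psum a y) -> in_disk z ->
  @is_derive C_AbsRing C_NormedModule f z (psum (deriv_coeffs a) z).
Proof.
intros Ha Hf Hz; destruct (psum_remainder a z Ha Hz) as [K HK].
apply (is_derive_of_remainder f z _ K).
eapply near0_imp; [|exact (near0_and _ _ HK (in_disk_near _ _ Hz))].
intros h [A B]; rewrite (Hf z Hz), (Hf (z + h) B); exact A.
Qed.

Lemma C_derive_psum (f : C -> C) (a : nat -> C) (z : C) :
  tame a -> (forall y, in_disk y -> f y = psum a y) -> in_disk z ->
  C_derive f z = psum (deriv_coeffs a) z.
Proof. intros; apply is_C_derive_unique; now apply is_derive_psum. Qed.

Lemma Cmod_4_add_ge (v w : C) :
  (Cmod v < 1)%R -> (Cmod w < 1)%R -> (2 <= Cmod (4 + v + w))%R.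
Proof.
intros Hv Hw.
assert (T := Cmod_triangle (4 + v + w) (- (v + w))).
replace (4 + v + w + - (v + w)) with (RtoC 4) in T by ring.
assert (T2 := Cmod_triangle v w).
rewrite Cmod_opp, Cmod_R, Rabs_pos_eq in T; lra.
Qed.

(* [w] inherits the regularity of [p = w (4 + w)] because
   [w z - w z0 = (p z - p z0) / (4 + w z + w z0)]. *)
Lemma expandable_of_quadratic (n : nat) (w p : C -> C) (z0 : C) :
  (forall z, in_disk z -> in_disk (w z)) ->
  (forall z, in_disk z -> p z = w z * (4 + w z)) ->
  in_disk z0 -> (forall m, expandable m (fun h => p (z0 + h))) ->
  expandable n (fun h => w (z0 + h)).
Proof.
(* Bootstrapping: order 0 is [|w| < 1], and each order of [w] in the denominator yields the next one
   for [w] itself. *)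
intros Hw Hp Hz He; induction n as [|n IH].
- exists 1%R; eapply near0_imp; [|exact (in_disk_near _ _ Hz)].
  intros h Hh; left; now apply Hw.
- destruct (He (S n)) as [c [p1 [H1 H2]]].
  exists (w z0), (fun h => p1 h * / (4 + w z0 + w (z0 + h))); split.
  + assert (Hc : c = p z0)
      by (assert (E := near0_at0 _ H1); cbv beta in E; rewrite Cplus_0_r in E;
          rewrite E; ring).
    eapply near0_imp; [|exact (near0_and _ _ H1 (in_disk_near _ _ Hz))].
    intros h [A B]; assert (B' := B : in_disk (z0 + h)).
    assert (N : 4 + w z0 + w (z0 + h) <> 0).
    { intros E; assert (L := Cmod_4_add_ge (w z0) (w (z0 + h)) (Hw _ Hz) (Hw _ B')).
      rewrite E, Cmod_0 in L; lra. }
    assert (E : h * p1 h = (w (z0 + h) - w z0) * (4 + w z0 + w (z0 + h))).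
    { replace (h * p1 h) with ((c + h * p1 h) - c) by ring.
      rewrite <- A, Hc, (Hp z0 Hz), (Hp _ B'); ring. }
    rewrite Cmult_assoc, E; field; auto.
  + apply (expandable_mul n p1); auto.
    apply (expandable_inv n (fun h => 4 + w z0 + w (z0 + h)) 2); [lra| |].
    * eapply near0_imp; [|exact (in_disk_near _ _ Hz)].
      intros h Hh; apply Cmod_4_add_ge; apply Hw; auto.
    * apply (expandable_add n (fun _ => 4 + w z0)); auto using expandable_const.
Qed.

Lemma schur_has_jet (n : nat) (g : C -> C) :
  (5 <= n)%nat -> schur_function n g ->
  exists e0 e1 e2 e3 e4, e0 = g 0 /\ has_jet g e0 e1 e2 e3 e4.
Proof.
intros Hn [H _].
destruct (expandable_has_jet g) as (e0 & e1 & e2 & e3 & e4 & J).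
- apply (expandable_ext 5 (fun h => g (0 + h))).
  + apply near0_all; intros h; now rewrite Cplus_0_l.
  + apply (expandable_le 5 n); auto using in_disk_0.
- exists e0, e1, e2, e3, e4; split; auto.
  destruct J as [r [_ E]]; rewrite (near0_at0 _ E); ring.
Qed.

(** Coefficients of [z], [z ^ 2] and [z ^ 3] on the two sides of the Schur identity. *)
Lemma schur_step_has_jet (g k : C -> C) (e0 e1 e2 e3 e4 f0 f1 f2 f3 f4 : C) :
  (forall z, in_disk z -> g z - g 0 = z * k z * (1 - Cconj (g 0) * g z)) ->
  e0 = g 0 -> has_jet g e0 e1 e2 e3 e4 -> has_jet k f0 f1 f2 f3 f4 ->
  e1 = f0 * defect e0 /\
  e2 = f1 * defect e0 - f0 * Cconj e0 * e1 /\
  e3 = f2 * defect e0 - f1 * Cconj e0 * e1 - f0 * Cconj e0 * e2.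
Proof.
intros H E Jg Jk; rewrite <- E in H.
assert (JL := has_jet_sub _ _ _ _ _ _ _ _ _ _ _ _ Jg (has_jet_const e0)).
assert (JR := has_jet_mul _ _ _ _ _ _ _ _ _ _ _ _
  (has_jet_mul _ _ _ _ _ _ _ _ _ _ _ _ has_jet_id Jk)
  (has_jet_sub _ _ _ _ _ _ _ _ _ _ _ _ (has_jet_const 1)
    (has_jet_mul _ _ _ _ _ _ _ _ _ _ _ _ (has_jet_const (Cconj e0)) Jg))).
destruct (has_jet_unique _ _ _ _ _ _ _ _ _ _ _ _
  (ex_intro _ 1%R (conj Rlt_0_1 H)) JL JR) as (_ & A & B & D & _).
unfold defect; repeat split.
- replace e1 with (e1 - 0) by ring; rewrite A; ring.
- replace e2 with (e2 - 0) by ring; rewrite B; ring.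
- replace e3 with (e3 - 0) at 1 by ring; rewrite D; ring.
Qed.

Lemma Cmult_4_inj (a b : C) : 4 * a = 4 * b -> a = b.
Proof.
intros H; replace a with (RtoC (/ 4) * (4 * a)).
- rewrite H, Cmult_assoc, <- RtoC_mult, Rinv_l by lra; ring.
- rewrite Cmult_assoc, <- RtoC_mult, Rinv_l by lra; ring.
Qed.

Lemma hankel3_upper_bound (f : C -> C) (a : nat -> C) :
  class_C phi_limacon f -> taylor_coeffs f a -> (Cmod (hankel3 a) <= 1 / 144)%R.
Proof.
intros [[Hf [Hf0 Hf1]] [Hnz [w [_ [Hw [Hw0 Hsub]]]]]] Hta.
assert (Ha : tame a).
{ apply tame_of_cseries; intros z Hz; exists (f z); now apply is_pseries_cseries, Hta. }
assert (Ef : forall z, in_disk z -> f z = psum a z).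
{ intros z Hz; symmetry; apply psum_unique; auto; now apply is_pseries_cseries, Hta. }
set (b := deriv_coeffs a); assert (Hb := tame_deriv_coeffs a Ha : tame b).
assert (EF : forall z, in_disk z -> C_derive f z = psum b z)
  by (intros; now apply C_derive_psum).
assert (EG : forall z, in_disk z -> C_derive (C_derive f) z = psum (deriv_coeffs b) z)
  by (intros; now apply C_derive_psum).
assert (Hd := tame_deriv_coeffs b Hb).
assert (Fnz : forall z, in_disk z -> psum b z <> 0)
  by (intros z Hz; rewrite <- EF by auto; auto).
assert (Heq : forall z, in_disk z ->
  4 * (z * psum (deriv_coeffs b) z) = w z * (4 + w z) * psum b z).
{ intros z Hz; assert (E := Hsub z Hz); rewrite EF, EG in E by auto.
  assert (N := Fnz z Hz).
  assert (E2 : 4 * (z * psum (deriv_coeffs b) z / psum b z) = w z * (4 + w z)).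
  { replace (z * psum (deriv_coeffs b) z / psum b z)
      with (1 + z * psum (deriv_coeffs b) z / psum b z - 1) by ring.
    rewrite E, phi_limaconE.
    assert (R4 : RtoC 4 <> 0) by (intros H; injection H; lra).
    field; auto. }
  rewrite <- E2; field; auto. }
assert (Hexp : forall n z0, in_disk z0 -> expandable n (fun h => w (z0 + h))).
{ intros n z0 Hz0.
  apply (expandable_of_quadratic n w
    (fun z => 4 * (z * psum (deriv_coeffs b) z) * / psum b z)); auto.
  - intros z Hz; rewrite Heq by auto; field; auto.
  - intros m.
    assert (PB : forall k, expandable k (fun h => psum b (z0 + h)))
      by (intros; now apply psum_expandable).
    assert (N := expandable_nonzero 0 _ (PB 1%nat)); cbv beta in N; rewrite Cplus_0_r in N.
    specialize (N (Fnz z0 Hz0)).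
    apply (expandable_mul m (fun h => 4 * ((z0 + h) * psum (deriv_coeffs b) (z0 + h)))).
    + apply (expandable_mul m (fun _ => 4)); auto using expandable_const.
      apply (expandable_mul m (fun h => z0 + h)); auto using expandable_shift.
      now apply psum_expandable.
    + apply (expandable_inv m (fun h => psum b (z0 + h)) _) with (2 := N); auto.
      assert (P := proj1 (Cmod_gt_0 _) (Fnz z0 Hz0)); lra. }
(* One division by [z] and three Schur steps cost four orders, and the last function must keep five
   for its jet. *)
assert (Sw : schur_function 9 w)
  by (split; auto; intros z Hz; left; now apply Hw).
destruct (schwarz_quotient 8 w ltac:(lia) Sw Hw0) as [g0 [S0 W0]].
destruct (schur_step 7 g0 ltac:(lia) S0) as [g1 [S1 R1]].
destruct (schur_step 6 g1 ltac:(lia) S1) as [g2 [S2 R2]].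
destruct (schur_step 5 g2 ltac:(lia) S2) as [g3 [S3 R3]].
destruct (schur_has_jet 8 g0 ltac:(lia) S0) as (c & c2 & c3 & c4 & c5 & Ec & J0).
destruct (schur_has_jet 7 g1 ltac:(lia) S1) as (x & x1 & x2 & x3 & x4 & Ex & J1).
destruct (schur_has_jet 6 g2 ltac:(lia) S2) as (y & y1 & y2 & y3 & y4 & Ey & J2).
destruct (schur_has_jet 5 g3 ltac:(lia) S3) as (u & u1 & u2 & u3 & u4 & Eu & J3).
destruct (schur_step_has_jet _ _ _ _ _ _ _ _ _ _ _ _ R1 Ec J0 J1) as (A1 & A2 & A3).
destruct (schur_step_has_jet _ _ _ _ _ _ _ _ _ _ _ _ R2 Ex J1 J2) as (B1 & B2 & _).
destruct (schur_step_has_jet _ _ _ _ _ _ _ _ _ _ _ _ R3 Ey J2 J3) as (D1 & _ & _).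
assert (JW := has_jet_mul _ _ _ _ _ _ _ _ _ _ _ _ has_jet_id J0).
assert (JR := has_jet_mul _ _ _ _ _ _ _ _ _ _ _ _
  (has_jet_mul _ _ _ _ _ _ _ _ _ _ _ _ JW
    (has_jet_add _ _ _ _ _ _ _ _ _ _ _ _ (has_jet_const 4) JW)) (psum_has_jet b Hb)).
assert (JL := has_jet_mul _ _ _ _ _ _ _ _ _ _ _ _ (has_jet_const 4)
  (has_jet_mul _ _ _ _ _ _ _ _ _ _ _ _ has_jet_id (psum_has_jet _ Hd))).
assert (Hloc : near0 (fun z => 4 * (z * psum (deriv_coeffs b) z) =
                               z * g0 z * (4 + z * g0 z) * psum b z)).
{ exists 1%R; split; [lra|]; intros z Hz; rewrite Heq, W0 by auto; ring. }
destruct (has_jet_unique _ _ _ _ _ _ _ _ _ _ _ _ Hloc JL JR) as (_ & T1 & T2 & T3 & T4).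
assert (b0 : b 0%nat = 1).
{ rewrite <- Hf1, EF, psum_step by auto using in_disk_0; ring. }
unfold deriv_coeffs in T1, T2, T3, T4.
assert (I1 : INR 1 = 1%R) by reflexivity.
assert (I2 : INR 2 = 2%R) by (simpl; ring).
assert (I3 : INR 3 = 3%R) by (simpl; ring).
assert (I4 : INR 4 = 4%R) by (simpl; ring).
assert (I5 : INR 5 = 5%R) by (simpl; ring).
rewrite I1, b0 in T1; rewrite I1, I2, b0 in T2; rewrite I1, I2, I3, b0 in T3.
rewrite I1, I2, I3, I4, b0 in T4.
assert (F1 : b 1%nat = 2 * a 2%nat) by (unfold b, deriv_coeffs; now rewrite I2).
assert (F2 : b 2%nat = 3 * a 3%nat) by (unfold b, deriv_coeffs; now rewrite I3).
assert (F3 : b 3%nat = 4 * a 4%nat) by (unfold b, deriv_coeffs; now rewrite I4).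
assert (F4 : b 4%nat = 5 * a 5%nat) by (unfold b, deriv_coeffs; now rewrite I5).
assert (b1 : b 1%nat = c).
{ apply Cmult_4_inj.
  match type of T1 with ?l = _ => transitivity l end; [ring|rewrite T1; ring]. }
rewrite b1 in T2, T3, T4.
(* The factors 8, 24, 384 clear the denominators. With [b k = (k + 1) * a (k + 1)] they become the
   24, 96, 1920 of [hankel3_schur_bound]. *)
assert (b2 : 8 * b 2%nat = 4 * c2 + 5 * c ^ 2).
{ match type of T2 with ?l = _ => transitivity l end; [ring|rewrite T2; ring]. }
assert (b3 : 24 * b 3%nat = 8 * c3 + 16 * c * c2 + 7 * c ^ 3).
{ match type of T3 with ?l = ?r => transitivity (2 * l); [ring|rewrite T3] end.
  match goal with |- ?l = _ =>
    replace l with (8 * c3 + 12 * c * c2 + 2 * c ^ 3 + c * (8 * b 2%nat)) by ring end.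
  rewrite b2; ring. }
assert (b4 : 384 * b 4%nat =
  96 * c4 + 176 * c * c3 + 72 * c2 ^ 2 + 184 * c ^ 2 * c2 + 43 * c ^ 4).
{ match type of T4 with ?l = ?r => transitivity (24 * l); [ring|rewrite T4] end.
  match goal with |- ?l = _ =>
    replace l with (96 * c4 + 48 * c * c3 + 24 * c2 ^ 2 + 96 * c * c3 + 48 * c ^ 2 * c2
      + 3 * (4 * c2 + c ^ 2) * (8 * b 2%nat) + 4 * c * (24 * b 3%nat)) by ring end.
  rewrite b2, b3; ring. }
apply (hankel3_schur_bound c x y u c2 c3 c4 a).
- rewrite Ec; apply S0, in_disk_0.
- rewrite Ex; apply S1, in_disk_0.
- rewrite Ey; apply S2, in_disk_0.
- rewrite Eu; apply S3, in_disk_0.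
- exact A1.
- rewrite A2, B1; ring.
- rewrite A3, B2, B1, D1; ring.
- now rewrite <- F1.
- rewrite <- b2, F2; ring.
- rewrite <- b3, F3; ring.
- rewrite <- b4, F4; ring.
Qed.

(** * The extremal function *)

(* [exp_coeff n k] is the coefficient of [z ^ n] in [z ^ k exp (z ^ 3 / 3 + z ^ 6 / 24)],
   by the recursion read off [F' = (z ^ 2 + z ^ 5 / 4) F]. *)
Fixpoint exp_coeff (n k : nat) : R :=
  match n, k with
  | O, O => 1
  | O, S _ => 0
  | S m, O => (exp_coeff m 2 + exp_coeff m 5 / 4) / INR (S m)
  | S m, S j => exp_coeff m j
  end.

Lemma exp_coeff_ge0 (n k : nat) : (0 <= exp_coeff n k)%R.
Proof.
revert k; induction n as [|n IH]; intros [|k]; simpl exp_coeff; try lra; auto.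
assert (H2 := IH 2%nat); assert (H5 := IH 5%nat).
apply Rdiv_le_0_compat; [lra|exact (lt_0_INR (S n) (Nat.lt_0_succ n))].
Qed.

(** [exp_coeff n 2] vanishes unless [n + 1 >= 3], and [exp_coeff n 5] vanishes unless [n + 1 >= 6],
    which gives the factors 1/3 and 1/(4 * 6). *)
Lemma exp_coeff_S_le (n : nat) :
  (exp_coeff (S n) 0 <= / 3 * exp_coeff n 2 + / 24 * exp_coeff n 5)%R.
Proof.
assert (H2 := exp_coeff_ge0 n 2); assert (H5 := exp_coeff_ge0 n 5).
change (exp_coeff (S n) 0) with ((exp_coeff n 2 + exp_coeff n 5 / 4) / INR (S n))%R.
assert (Hn : (0 < INR (S n))%R) by (apply lt_0_INR; lia).
apply Rle_div_l; auto.
destruct (Nat.lt_ge_cases n 2) as [L|L].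
{ assert (Z2 : exp_coeff n 2 = 0%R) by (destruct n as [|[|n]]; [reflexivity..|lia]).
  assert (Z5 : exp_coeff n 5 = 0%R) by (destruct n as [|[|n]]; [reflexivity..|lia]).
  rewrite Z2, Z5; lra. }
assert (N3 : (3 <= INR (S n))%R)
  by (apply Rle_trans with (INR 3); [simpl; lra|apply le_INR; lia]).
destruct (Nat.lt_ge_cases n 5) as [L5|L5].
{ assert (Z5 : exp_coeff n 5 = 0%R)
    by (destruct n as [|[|[|[|[|n]]]]]; [reflexivity..|lia]).
  rewrite Z5; nra. }
assert (N6 : (6 <= INR (S n))%R)
  by (apply Rle_trans with (INR 6); [simpl; lra|apply le_INR; lia]).
nra.
Qed.

Lemma exp_coeff_le1 (n k : nat) : (exp_coeff n k <= 1)%R.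
Proof.
revert k; induction n as [|n IH]; intros [|k]; try (simpl exp_coeff; lra); [|apply IH].
assert (H := exp_coeff_S_le n); assert (H2 := IH 2%nat); assert (H5 := IH 5%nat); lra.
Qed.

Definition exp_series (k n : nat) : C := RtoC (exp_coeff n k).

Lemma Cmod_exp_series (k n : nat) : Cmod (exp_series k n) = exp_coeff n k.
Proof. unfold exp_series; rewrite Cmod_R; apply Rabs_pos_eq, exp_coeff_ge0. Qed.

Lemma tame_of_bounded (a : nat -> C) : (forall n, (Cmod (a n) <= 1)%R) -> tame a.
Proof.
intros H r Hr; exists 1%R; intros n.
assert (0 <= r ^ n <= 1)%R
  by (split; [apply pow_le; lra|rewrite <- (pow1 n); apply pow_incr; lra]).
specialize (H n); pose proof (Cmod_ge_0 (a n)); nra.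
Qed.

Lemma tame_exp_series (k : nat) : tame (exp_series k).
Proof. apply tame_of_bounded; intros n; rewrite Cmod_exp_series; apply exp_coeff_le1. Qed.

Lemma psum_exp_series_S (k : nat) (z : C) :
  in_disk z -> psum (exp_series (S k)) z = z * psum (exp_series k) z.
Proof.
intros Hz; rewrite psum_step by auto using tame_exp_series.
change (exp_series (S k) 0) with (RtoC 0).
change (fun n => exp_series (S k) (S n)) with (exp_series k); ring.
Qed.

Lemma is_series_exp_coeff_S (k : nat) (t L : R) :
  is_series (fun n => exp_coeff n k * t ^ n)%R L ->
  is_series (fun n => exp_coeff n (S k) * t ^ n)%R (t * L)%R.
Proof.
intros H; apply (is_series_decr_1 (K := R_AbsRing) (V := R_NormedModule)).
change (is_series (fun n => exp_coeff n k * (t * t ^ n))%R (t * L + - (0 * 1))%R).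
replace (t * L + - (0 * 1))%R with (t * L)%R by ring.
eapply is_series_ext; [|exact (is_series_scal (K := R_AbsRing) (V := R_NormedModule) t _ _ H)].
intros n; change (t * (exp_coeff n k * t ^ n) = exp_coeff n k * (t * t ^ n))%R; ring.
Qed.

(* With [M] the sum of the majorant series at [t = |z|], the recursion gives
   [M - 1 <= t ^ 3 M / 3 + t ^ 6 M / 24 <= 3 M / 8]. *)
Lemma psum_exp_series_neq0 (z : C) : in_disk z -> psum (exp_series 0) z <> 0.
Proof.
intros Hz HF; unfold in_disk in Hz; assert (Pz := Cmod_ge_0 z).
set (t := Cmod z) in *.
destruct (tame_majorant _ t (tame_exp_series 0)) as [M HM]; [lra|].
assert (H0 : is_series (fun n => exp_coeff n 0 * t ^ n)%R M).
{ eapply is_series_ext; [|exact HM]; intros n; cbv beta; now rewrite Cmod_exp_series. }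
assert (H1 := is_series_exp_coeff_S _ _ _ H0); assert (H2 := is_series_exp_coeff_S _ _ _ H1).
assert (H3 := is_series_exp_coeff_S _ _ _ H2); assert (H4 := is_series_exp_coeff_S _ _ _ H3).
assert (H5 := is_series_exp_coeff_S _ _ _ H4).
set (L := (t * (/ 3 * (t * (t * M)) + / 24 * (t * (t * (t * (t * (t * M)))))))%R).
assert (HB : is_series
  (fun n => t * (/ 3 * (exp_coeff n 2 * t ^ n) + / 24 * (exp_coeff n 5 * t ^ n)))%R L).
{ apply (is_series_scal (K := R_AbsRing) (V := R_NormedModule) t).
  apply (is_series_plus (K := R_AbsRing) (V := R_NormedModule));
    apply (is_series_scal (K := R_AbsRing) (V := R_NormedModule)); auto. }
assert (Hle : forall n, (exp_coeff (S n) 0 * t ^ S n <=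
  t * (/ 3 * (exp_coeff n 2 * t ^ n) + / 24 * (exp_coeff n 5 * t ^ n)))%R).
{ intros n; assert (E := exp_coeff_S_le n).
  assert (0 <= t ^ S n)%R by now apply pow_le.
  simpl pow in *; nra. }
assert (HS : is_series (fun n => exp_coeff (S n) 0 * t ^ S n)%R (M - 1)%R).
{ apply (is_series_incr_1 (K := R_AbsRing) (V := R_NormedModule)
    (fun n => exp_coeff n 0 * t ^ n)%R).
  assert (E : M = (M - 1 + exp_coeff 0 0 * t ^ 0)%R) by (simpl; ring).
  assert (H0' := H0); rewrite E in H0'; exact H0'. }
assert (HML : (M - 1 <= L)%R).
{ refine (is_lim_seq_le _ _ (Finite (M - 1)) (Finite L) _ HS HB).
  intros n; apply sum_n_m_le; exact Hle. }
assert (HM0 : (0 <= M)%R).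
{ replace 0%R with (Cmod 0) by apply Cmod_0; rewrite <- HF.
  eapply cseries_Cmod_le; [apply psum_spec; auto using tame_exp_series| |exact HM].
  intros n; cbv beta; rewrite Cmod_mult, Cmod_pow; fold t; lra. }
assert (HL : (L <= 3 / 8 * M)%R).
{ assert (T3 : (0 <= t ^ 3 <= 1)%R)
    by (split; [now apply pow_le|rewrite <- (pow1 3); apply pow_incr; lra]).
  assert (T6 : (0 <= t ^ 6 <= 1)%R)
    by (split; [now apply pow_le|rewrite <- (pow1 6); apply pow_incr; lra]).
  replace L with (/ 3 * (t ^ 3 * M) + / 24 * (t ^ 6 * M))%R by (unfold L; ring).
  nra. }
assert (HF1 : (Cmod (psum (exp_series 0) z - 1) <= M - 1)%R).
{ eapply cseries_Cmod_le; [| |exact HS].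
  - assert (T := cseries_tail _ _ (psum_spec _ z (tame_exp_series 0) Hz)).
    assert (E : z ^ 0 * exp_series 0 0 = 1) by (change (1 * 1 = RtoC 1); ring).
    cbv beta in T; rewrite E in T; exact T.
  - intros n; cbv beta; rewrite Cmod_mult, Cmod_pow, Cmod_exp_series; fold t; lra. }
(* A zero of the series would force [1 <= M - 1], whereas [M - 1 <= 3 / 8 * M] means
   [M <= 8 / 5]. *)
rewrite HF in HF1; replace (0 - 1) with (- RtoC 1) in HF1 by ring.
rewrite Cmod_opp, Cmod_1 in HF1; lra.
Qed.

(** The termwise integral of [exp_series 0]. *)
Definition extremal_coeffs (n : nat) : C :=
  match n with O => 0 | S m => exp_series 0 m * RtoC (/ INR (S m)) end.

Lemma tame_extremal_coeffs : tame extremal_coeffs.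
Proof.
apply tame_of_bounded; intros [|n]; simpl extremal_coeffs; [rewrite Cmod_0; lra|].
assert (H1 : (1 <= INR (S n))%R) by (apply (le_INR 1); lia).
assert (H2 : (0 < / INR (S n) <= 1)%R).
{ split; [apply Rinv_0_lt_compat; lra|].
  rewrite <- Rinv_1; apply Rinv_le_contravar; lra. }
change (Cmod (exp_series 0 n * RtoC (/ INR (S n))) <= 1)%R.
rewrite Cmod_mult, Cmod_exp_series, Cmod_R, Rabs_pos_eq by lra.
assert (P := exp_coeff_ge0 n 0); assert (Q := exp_coeff_le1 n 0); nra.
Qed.

Lemma deriv_extremal_coeffs (n : nat) : deriv_coeffs extremal_coeffs n = exp_series 0 n.
Proof.
unfold deriv_coeffs; change (extremal_coeffs (S n)) with (exp_series 0 n * RtoC (/ INR (S n))).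
rewrite (Cmult_comm (exp_series 0 n)), Cmult_assoc, <- RtoC_mult, Rinv_r, Cmult_1_l; auto.
apply not_0_INR; lia.
Qed.

Lemma psum_ext (a b : nat -> C) (z : C) :
  tame a -> (forall n, a n = b n) -> in_disk z -> psum a z = psum b z.
Proof.
intros Ha E Hz.
assert (Hb : tame b).
{ intros r Hr; destruct (Ha r Hr) as [M HM]; exists M; intros n; now rewrite <- E. }
apply psum_unique; auto.
eapply cseries_ext; [|apply (psum_spec b); auto]; intros n; cbv beta; now rewrite E.
Qed.

Lemma psum_deriv_exp_series (z : C) :
  in_disk z ->
  psum (deriv_coeffs (exp_series 0)) z =
  (z ^ 2 + z ^ 5 / 4) * psum (exp_series 0) z.
Proof.
intros Hz; apply psum_unique; auto using tame_deriv_coeffs, tame_exp_series.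
assert (R4 : RtoC 4 <> 0) by (intros H; injection H; lra).
replace ((z ^ 2 + z ^ 5 / 4) * psum (exp_series 0) z)
  with (psum (exp_series 2) z + / 4 * psum (exp_series 5) z)
  by (rewrite !psum_exp_series_S by auto; field; auto).
eapply cseries_ext; [|apply cseries_add; [|apply cseries_scal];
  apply psum_spec; auto using tame_exp_series].
intros n; cbv beta; unfold deriv_coeffs, exp_series.
change (exp_coeff (S n) 0) with ((exp_coeff n 2 + exp_coeff n 5 / 4) / INR (S n))%R.
rewrite <- RtoC_mult.
replace (INR (S n) * ((exp_coeff n 2 + exp_coeff n 5 / 4) / INR (S n)))%R
  with (exp_coeff n 2 + exp_coeff n 5 * / 4)%R
  by (field; apply not_0_INR; lia).
rewrite RtoC_plus, RtoC_mult, RtoC_inv by lra; ring.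
Qed.

Lemma ex_derive_cube (z : C) : @ex_derive C_AbsRing C_NormedModule (fun y => y ^ 3) z.
Proof.
exists (3 * z ^ 2); apply (is_derive_of_remainder (fun y => y ^ 3) z _ (3 * Cmod z + 1)).
exists 1%R; split; [lra|]; intros h Hh.
replace ((z + h) ^ 3 - z ^ 3 - h * (3 * z ^ 2)) with ((3 * z + h) * h ^ 2) by ring.
rewrite Cmod_mult, Cmod_pow; apply Rmult_le_compat_r; [apply pow2_ge_0|].
eapply Rle_trans; [apply Cmod_triangle|].
rewrite Cmod_mult, Cmod_R, Rabs_pos_eq; lra.
Qed.

Lemma extremal_class_C : class_C phi_limacon (psum extremal_coeffs).
Proof.
assert (Ta := tame_extremal_coeffs).
assert (Td := tame_deriv_coeffs _ Ta).
assert (EF : forall z, in_disk z -> C_derive (psum extremal_coeffs) z = psum (exp_series 0) z).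
{ intros z Hz; rewrite (C_derive_psum _ extremal_coeffs z) by auto.
  apply psum_ext; auto using deriv_extremal_coeffs. }
assert (EG : forall z, in_disk z -> C_derive (C_derive (psum extremal_coeffs)) z =
    (z ^ 2 + z ^ 5 / 4) * psum (exp_series 0) z).
{ intros z Hz; rewrite <- psum_deriv_exp_series by auto.
  apply C_derive_psum; auto using tame_exp_series. }
split; [split; [|split]|split].
- intros z Hz; eexists; apply (is_derive_psum _ extremal_coeffs); auto.
- rewrite psum_step by auto using in_disk_0; simpl extremal_coeffs; ring.
- rewrite EF, psum_step by auto using in_disk_0, tame_exp_series.
  change (exp_series 0 0) with (RtoC 1); ring.
- intros z Hz; rewrite EF by auto; now apply psum_exp_series_neq0.
(* Here [z f'' / f' = z ^ 3 + z ^ 6 / 4], which is [phi_limacon (z ^ 3) - 1]. *)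
- exists (fun z => z ^ 3); split; [|split; [|split]].
  + intros z _; apply ex_derive_cube.
  + intros z Hz; unfold in_disk in *; rewrite Cmod_pow.
    pose proof (Cmod_ge_0 z); simpl; nra.
  + ring.
  + intros z Hz; rewrite EF, EG, phi_limaconE by auto.
    assert (N := psum_exp_series_neq0 z Hz).
    assert (R4 : RtoC 4 <> 0) by (intros H; injection H; lra).
    field; auto.
Qed.

(** Since [a 2] and [a 3] vanish, only [- a 4 ^ 2] is left, and [a 4] is 1/3 divided by 4. *)
Lemma hankel3_extremal : hankel3 extremal_coeffs = RtoC (- (1 / 144)).
Proof.
assert (A2 : extremal_coeffs 2 = 0).
{ change (RtoC ((0 + 0 / 4) / 1) * RtoC (/ INR 2) = 0).
  replace ((0 + 0 / 4) / 1)%R with 0%R by field; ring. }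
assert (A3 : extremal_coeffs 3 = 0).
{ change (RtoC ((0 + 0 / 4) / INR 2) * RtoC (/ INR 3) = 0).
  replace ((0 + 0 / 4) / INR 2)%R with 0%R by (simpl; field); ring. }
assert (A4 : extremal_coeffs 4 = RtoC (/ 12)).
{ change (RtoC ((1 + 0 / 4) / INR 3) * RtoC (/ INR 4) = RtoC (/ 12)).
  rewrite <- RtoC_mult; f_equal; simpl; field. }
rewrite hankel3E, A2, A3, A4.
replace (- (1 / 144))%R with (- (/ 12 * / 12))%R by field.
rewrite RtoC_opp, RtoC_mult; ring.
Qed.

Theorem theorem3p2 :
  (forall (f : C -> C) (a : nat -> C),
     class_C phi_limacon f -> taylor_coeffs f a ->
     (Cmod (hankel3 a) <= 1 / 144)%R) /\
  (exists (f : C -> C) (a : nat -> C),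
     class_C phi_limacon f /\ taylor_coeffs f a /\
     Cmod (hankel3 a) = (1 / 144)%R).
Proof.
split; [exact hankel3_upper_bound|].
exists (psum extremal_coeffs), extremal_coeffs; split; [exact extremal_class_C|split].
- intros z Hz; apply is_pseries_cseries, psum_spec; auto using tame_extremal_coeffs.
- rewrite hankel3_extremal, Cmod_R, Rabs_Ropp, Rabs_pos_eq; lra.
Qed.
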